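(* Let $\alpha,\beta$ be integers different from $1$ with $v_2(\alpha-1)=v_2(\beta-1)=m>1$, and suppose $\ell\ge 2m$, where $\ell=v_2(\alpha-\beta)$ (with $\ell=\infty$ if $\alpha=\beta$). Then $|G_2|=2^{7m-3}$, the nilpotency class of $G_2$ is $5$, $o(a)=o(b)=2^{3m-1}$ and $o(c)=2^{2m}$.
   Context: $G(\alpha,\beta)=\langle A,B\mid A^{[A,B]}=A^{\alpha},\ B^{[B,A]}=B^{\beta}\rangle$ with $[x,y]=x^{-1}y^{-1}xy$, $y^x=x^{-1}yx$, and $C=[A,B]$. The group $G(\alpha,\beta)$ is finite and nilpotent, hence the direct product of its Sylow subgroups; $G_2$ denotes its Sylow $2$-subgroup and $a,b,c$ denote the images of $A,B,C$ under the canonical projection $G(\alpha,\beta)\to G_2$. $v_2$ is the $2$-adic valuation and $o(x)$ the order of $x$. *)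

(* Defs.v *)
From HB Require Import structures.
From mathcomp Require Import all_boot all_order all_algebra all_fingroup all_solvable.
Set Implicit Arguments. Unset Strict Implicit. Unset Printing Implicit Defensive.
Import GRing.Theory Num.Theory.

Local Open Scope group_scope.

Definition zexpg (gT : finGroupType) (x : gT) (k : int) : gT :=
  if (0 <= k)%R then x ^+ `|k|%N else x ^- `|k|%N.

(* The two defining relations of G(alpha,beta):
   A^[A,B] = A^alpha,  B^[B,A] = B^beta
   (MathComp: x ^ y = y^-1 x y, [~ x, y] = x^-1 y^-1 x y, as in the paper). *)
Definition rels_ab (gT : finGroupType) (x y : gT) (alpha beta : int) : bool :=
  (x ^ [~ x, y] == zexpg x alpha) && (y ^ [~ y, x] == zexpg y beta).

(* (G, A, B) is (a copy of) the finitely presented group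
   G(alpha,beta) = < A, B | A^[A,B] = A^alpha, B^[B,A] = B^beta >
   together with its generators: G is generated by A, B, which satisfy the
   relations, and G has the universal property of the presentation with
   respect to finite groups.  Since G(alpha,beta) is finite, this pins down
   G(alpha,beta) with its generators up to isomorphism. *)
Definition is_Gab (gT : finGroupType) (G : {group gT}) (A B : gT)
    (alpha beta : int) : Prop :=
  [/\ G :=: <<[set A; B]>>, rels_ab A B alpha beta &
      forall (rT : finGroupType) (x y : rT), rels_ab x y alpha beta ->
        exists f : {morphism G >-> rT}, f A = x /\ f B = y].

Definition v2 (z : int) : nat := logn 2 `|z|%N.

(* Main.v *)
(** Put [c = [a, b]].  The first relation gives
    [(a ^ n) ^ b = c ^ n * a ^ (al + al^2 + ... + al^n)], and symmetrically for [b].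

    Nilpotency: these formulas force [c ^ #[a] = c ^ #[b] = 1].  If [p] is the largest
    prime dividing [#[a] * #[b]], then one of [a ^ (#[a] / p)], [b ^ (#[b] / p)],
    [c ^ (#[c] / p)] is central and nontrivial; induct on the order.  Hence [G] is
    nilpotent and [x |-> x.`_2] maps it onto [G2].

    Upper bound: let [h = 2 ^ (m - 1)] and [q = 2 h^2].  Computing [[a, b ^ be]] in two
    ways yields [c ^ (al - be) = s * a ^ (q x)] with [x] odd and [<s> = <b ^ q>].
    Conjugating this by [c] and by [b] shows that [<a ^ q> = <b ^ q>] is central, that
    [a ^ (4 h^3) = 1] and that [<c ^ q> = <a ^ (2 h^3)>].  Since [G2 = <a><c><b>], its
    order is at most [4 h^3 q q = 2 ^ (7m - 3)], and its upper central series can be read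
    off.

    Lower bound: in the would-be normal form [a^i [b,a]^k b^j], right multiplication by
    [a] and by [b] is explicit.  This gives two permutations of a set of [4 h^3 q q]
    elements which generate a transitive group and satisfy the relations, as one checks
    by expanding modulo [4 h^3]. *)
Require Import Defs.
From HB Require Import structures.
From mathcomp Require Import all_boot all_order all_algebra all_fingroup all_solvable.
From mathcomp Require Import zify ring.

Set Implicit Arguments. Unset Strict Implicit. Unset Printing Implicit Defensive.

Import GRing.Theory Num.Theory.

Local Open Scope group_scope.

(** * Power sums *)

(* [a + a^2 + ... + a^n], in Horner form. *)
Definition gsum (a n : nat) : nat := iter n (fun e => a * e.+1)%N 0%N.

Arguments gsum : simpl never.

Lemma gsumS a n : gsum a n.+1 = (a * (gsum a n).+1)%N.
Proof. by []. Qed.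

Lemma gsumSr a n : gsum a n.+1 = (gsum a n + a ^ n.+1)%N.
Proof.
elim: n => [|n IHn]; first by rewrite gsumS /= expn1 muln1.
by rewrite gsumS {1}IHn gsumS (expnS a n.+1); lia.
Qed.

Lemma gsumD a n k : gsum a (n + k) = (gsum a n + a ^ n * gsum a k)%N.
Proof.
elim: k => [|k IHk]; first by rewrite muln0 !addn0.
by rewrite addnS !gsumSr IHk expnS expnD expnS; lia.
Qed.

Lemma gsum_pred a n : (a.-1 * gsum a n = a * (a ^ n).-1)%N.
Proof.
elim: n => [|n IHn]; first by rewrite muln0 expn0 muln0.
case: a IHn => [|a] /= IHn; first by rewrite !mul0n.
rewrite gsumSr mulnDr IHn expnS -!subn1.
have: (0 < a.+1 ^ n)%N by rewrite expn_gt0.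
by move: (a.+1 ^ n)%N => X; nia.
Qed.

(** Cutting the sum into [k] blocks of length [n] leaves a geometric sum in [a ^ n]; with [k = p]
    this gains one factor [p] at a time. *)
Lemma gsumM a n k : gsum a (n * k) = (gsum a n * \sum_(t < k) (a ^ n) ^ t)%N.
Proof.
elim: k => [|k IHk]; first by rewrite muln0 big_ord0 muln0.
by rewrite mulnS addnC gsumD IHk big_ord_recr /= -expnM; lia.
Qed.

Lemma sum_pow1_mod a d n : (a = 1 %[mod d] -> \sum_(t < n) a ^ t = n %[mod d])%N.
Proof.
move=> ha; elim: n => [|n IHn]; first by rewrite big_ord0.
rewrite big_ord_recr /= -modnDm IHn -modnXm ha modnXm exp1n modnDm.
by rewrite addn1.
Qed.

(** Each [p]-th power gains a factor [p]: in [b^p - 1 = (b - 1)(1 + b + ... + b^(p-1))] the last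
    factor is a sum of [p] terms equal to 1 modulo [p]. *)
Lemma pow1_mod_lift p a k :
  (0 < a -> a = 1 %[mod p] -> a ^ (p ^ k) = 1 %[mod p ^ k.+1])%N.
Proof.
move=> a_gt0 ha; elim: k => [|k IHk]; first by rewrite expn0 !expn1.
have ha' : (a ^ p ^ k = 1 %[mod p])%N by rewrite -modnXm ha modnXm exp1n.
have b_gt0 n : (0 < a ^ n)%N by rewrite expn_gt0 a_gt0.
apply/eqP; rewrite eqn_mod_dvd // (expnSr p k) expnM.
rewrite subn1 predn_exp (expnSr p k.+1) dvdn_mul //.
  by rewrite -subn1 -eqn_mod_dvd //; apply/eqP.
by rewrite /dvdn (sum_pow1_mod _ ha') modnn.
Qed.

Lemma dvdn_gsum p v a n : (a = 1 %[mod p] -> p ^ v %| n -> p ^ v %| gsum a n)%N.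
Proof.
move=> ha /dvdnP[w ->]; rewrite mulnC gsumM; apply: dvdn_mulr.
elim: v => [|v IHv]; first by rewrite expn0 dvd1n.
rewrite !expnSr gsumM dvdn_mul // /dvdn sum_pow1_mod ?modnn //.
by rewrite -modnXm ha modnXm exp1n.
Qed.

Lemma dvdn_gsum_coprime d a n :
  (0 < a -> coprime d a.-1 -> a ^ n = 1 %[mod d] -> d %| gsum a n)%N.
Proof.
move=> a_gt0 cop ha; rewrite -(Gauss_dvdr _ cop) gsum_pred dvdn_mull //.
by rewrite -subn1 -eqn_mod_dvd ?expn_gt0 ?a_gt0 //; apply/eqP.
Qed.

Lemma pred_mod1 p a : (0 < a -> p %| a.-1 -> a = 1 %[mod p])%N.
Proof. by move=> a_gt0 pa; apply/eqP; rewrite eqn_mod_dvd // subn1. Qed.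

Lemma eqmod_dvdn d e x y : (d %| e -> x = y %[mod e] -> x = y %[mod d])%N.
Proof. by move=> de exy; rewrite -(modn_dvdm x de) exy modn_dvdm. Qed.

(** One prime [p] of [n] at a time: if [p] divides [a - 1], the sum has at least as many factors [p]
    as its length; otherwise [a - 1] is invertible modulo powers of [p] and the closed form of the
    geometric sum applies. *)
Lemma dvdn_gsum_order n a : (0 < n -> 0 < a -> a ^ n = 1 %[mod n] -> n %| gsum a n)%N.
Proof.
move=> n_gt0 a_gt0 ha; apply/dvdn_partP => // p; rewrite mem_primes.
case/andP=> p_pr _; rewrite p_part.
have [pa|npa] := boolP (p %| a.-1)%N.
  by apply: dvdn_gsum; rewrite ?pfactor_dvdnn //; apply: pred_mod1.
apply: dvdn_gsum_coprime => //; first by rewrite coprimeXl ?prime_coprime.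
by apply: (eqmod_dvdn _ ha); rewrite pfactor_dvdnn.
Qed.

(** * Nilpotency *)

Section Relation.

Variables (gT : finGroupType) (A B : gT) (al : nat).
Hypothesis relA : A ^ [~ A, B] = A ^+ al.

Let C := [~ A, B].

Lemma conj_relA j n : (A ^+ j) ^ (C ^+ n) = A ^+ (j * al ^ n).
Proof.
elim: n => [|n IHn]; first by rewrite conjg1 muln1.
by rewrite expgSr conjgM IHn conjXg relA -expgM expnS mulnCA.
Qed.

Lemma relA_swap j n : A ^+ j * C ^+ n = C ^+ n * A ^+ (j * al ^ n).
Proof. by rewrite conjgC conj_relA. Qed.

Lemma conj_comm : A ^ B = A * C.
Proof. by rewrite /C commgEl mulKVg. Qed.

(** This collects [(A C)^n]: moving a [C] to the left across [A ^ (e + 1)] turns the exponent into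
    [al (e + 1)], the Horner step of [gsum]. *)
Lemma conj_expA n : (A ^+ n) ^ B = C ^+ n * A ^+ gsum al n.
Proof.
rewrite conjXg conj_comm; elim: n => [|n IHn]; first by rewrite !expg0 mulg1.
rewrite expgSr IHn -!mulgA (mulgA _ A) -expgSr -[C in LHS]expg1 relA_swap.
by rewrite expn1 mulgA -expgSr gsumS mulnC.
Qed.

Lemma pow_al_order_comm n : C ^+ n \in 'C[A] -> (al ^ n = 1 %[mod #[A]])%N.
Proof.
move=> cAC; apply/eqP; rewrite -eq_expg_mod_order expg1 -[X in A ^+ X]mul1n.
by rewrite -conj_relA expg1 (conjg_fixP _) //; apply/commgP/esym/cent1P.
Qed.

(** With [n = #[A]], [conj_expA] makes [C ^ n] a power of [A], so it commutes with [A] and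
    [al ^ n = 1] modulo [n]. Then [n] divides the power sum, and the factor in [A] disappears. *)
Lemma comm_pow_order : C ^+ #[A] = 1.
Proof.
have eC : C ^+ #[A] * A ^+ gsum al #[A] = 1.
  by rewrite -conj_expA expg_order conj1g.
have cC : C ^+ #[A] \in 'C[A].
  rewrite -[C ^+ _](mulgK (A ^+ gsum al #[A])) eC mul1g groupV groupX //.
  exact/cent1P.
have [al0|al_gt0] := posnP al.
  move: relA; rewrite al0 expg0 => /eqP; rewrite conjg_eq1 => /eqP A1.
  by rewrite /C A1 comm1g expg1n.
have : (#[A] %| gsum al #[A])%N.
  by apply: dvdn_gsum_order => //; apply: pow_al_order_comm.
by case/dvdnP=> w ew; rewrite ew mulnC expgM expg_order expg1n mulg1 in eC.
Qed.

End Relation.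

(** * Central elements of prime order *)

Lemma eqmodn1P p a : (0 < a -> a = 1 %[mod p] -> exists z, a = 1 + p * z)%N.
Proof.
move=> a_gt0 /eqP; rewrite eqn_mod_dvd // => /dvdnP[z e].
by exists z; rewrite mulnC -e subnKC.
Qed.

Lemma sum_pow_mod_sqr p z n :
  (\sum_(t < n) (1 + p * z) ^ t = n + p * z * 'C(n, 2) %[mod p ^ 2])%N.
Proof.
have e1 t : ((1 + p * z) ^ t = 1 + p * z * t %[mod p ^ 2])%N.
  elim: t => [|t IHt]; first by rewrite muln0.
  rewrite expnS -modnMmr IHt modnMmr -(modnMDl (z * z * t) (1 + _)).
  by congr (_ %% _)%N; ring.
elim: n => [|n IHn]; first by rewrite big_ord0 muln0.
rewrite big_ord_recr /= -modnDm IHn e1 modnDm binS bin1; congr (_ %% _)%N; ring.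
Qed.

(** Sharpens [dvdn_gsum] by one power of [p]: the sum of the first [p] powers of [1 + p z] is
    [p + p z 'C(p, 2)] modulo [p ^ 2], and an odd [p] divides ['C(p, 2)]. *)
Lemma gsum_pfactor p a k w : prime p -> odd p -> (0 < a)%N ->
  (a = 1 %[mod p] -> gsum a (p ^ k * w) = p ^ k * w %[mod p ^ k.+1])%N.
Proof.
move=> p_pr p_odd a_gt0 ha.
have hb i : (a ^ i = 1 %[mod p])%N by rewrite -modnXm ha modnXm exp1n.
have p3 : (2 < p)%N by case: p p_pr p_odd {ha hb} => [|[|[|p]]].
suff: (gsum a (p ^ k) = p ^ k %[mod p ^ k.+1])%N.
  move=> e; rewrite gsumM; apply/eqP.
  rewrite -modnMml e modnMml expnSr -!muln_modr.
  by rewrite (sum_pow1_mod _ (hb _)).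
elim: k => [|k IHk]; first by rewrite !expn1 /gsum /= muln1.
rewrite {1}expnSr gsumM.
have [z ->] : exists z, (a ^ p ^ k = 1 + p * z)%N.
  by apply: eqmodn1P; rewrite ?expn_gt0 ?a_gt0.
have /dvdnP[x ex] : (p ^ k %| gsum a (p ^ k))%N by apply: dvdn_gsum.
move: IHk; rewrite ex => ek.
have xp : (x = 1 %[mod p])%N.
  apply/eqP; rewrite -(@eqn_pmul2l (p ^ k)) ?expn_gt0 ?prime_gt0 //.
  by rewrite !muln_modr -expnSr muln1 mulnC ek.
have /dvdnP[y ey] : (p %| 'C(p, 2))%N by apply: prime_dvd_bin.
have := sum_pow_mod_sqr p z p; rewrite ey.
set S := (\sum_(t < p) _)%N => eS.
have {}eS : (S = p %[mod p ^ 2])%N.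
  by rewrite eS -(modnMDl (z * y) p); congr (_ %% _)%N; ring.
have /dvdnP[s es] : (p %| S)%N.
  have: (p %| p ^ 2)%N by rewrite dvdn_exp.
  by move=> d; rewrite /dvdn -(modn_dvdm S d) eS (modn_dvdm p d) modnn.
have sp : (s = 1 %[mod p])%N.
  apply/eqP; rewrite -(@eqn_pmul2l p) ?prime_gt0 //.
  by rewrite !muln_modr -[(p * p)%N]/(p ^ 2)%N muln1 mulnC -es eS.
have -> : (x * p ^ k * S = p ^ k.+1 * (x * s))%N by rewrite es expnS; ring.
by rewrite (expnSr p k.+1) -muln_modr -modnMm xp sp modnMm muln_modr !muln1.
Qed.

Section Central.

Variables (gT : finGroupType) (A B : gT) (al p : nat).
Hypothesis relA : A ^ [~ A, B] = A ^+ al.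
Hypotheses (p_pr : prime p) (pA : (p %| #[A])%N).
Let n := #[A].

(** Conjugation by [B] acts on [A ^ j], of order [p], as the [l]-th power with [l = gsum al j / j];
    the point is that [l = 1] modulo [p]. *)
Lemma conj_expA_top : [~ A, B] ^+ (n %/ p) = 1 ->
  (A ^+ (n %/ p)) ^ B = A ^+ (n %/ p).
Proof.
set j := (n %/ p)%N => Cj1.
have nE : n = (j * p)%N by rewrite divnK.
have p_gt0 := prime_gt0 p_pr.
have n_gt0 : (0 < n)%N := order_gt0 A.
have j_gt0 : (0 < j)%N by rewrite divn_gt0 // dvdn_leq.
have zN1 : A ^+ j != 1.
  rewrite -order_dvdn; apply/negP => /(dvdn_leq j_gt0).
  by rewrite -/n nE leqNgt ltn_Pmulr // prime_gt1.
have eB : (A ^+ j) ^ B = A ^+ gsum al j.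
  by rewrite (conj_expA relA) Cj1 mul1g.
have al_gt0 : (0 < al)%N.
  rewrite lt0n; apply/eqP => al0; move: relA zN1.
  by rewrite al0 expg0 => /eqP; rewrite conjg_eq1 => /eqP->; rewrite expg1n eqxx.
have /dvdnP[l el] : (j %| gsum al j)%N.
  rewrite -(@dvdn_pmul2r p) // -nE order_dvdn expgM -eB -conjXg -expgM -nE.
  by rewrite expg_order conj1g.
have npl : ~~ (p %| l)%N.
  apply: contra zN1 => /dvdnP[t et]; rewrite -(conjg_eq1 _ B) eB el et.
  by rewrite mulnAC -mulnA -nE mulnC expgM expg_order expg1n.
have [k [w pw ej]] : exists k, exists2 w, coprime p w & j = (w * p ^ k)%N.
  by have [w pw ew] := pfactor_coprime p_pr j_gt0; exists (logn p j), w.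
have pk_n : (p ^ k.+1 %| n)%N by rewrite nE ej expnSr -mulnA dvdn_mull.
have pk_gt0 : (0 < p ^ k)%N by rewrite expn_gt0 p_gt0.
suff l1 : (l = 1 %[mod p])%N.
  rewrite eB el; apply/eqP; rewrite eq_expg_mod_order -/n nE.
  by rewrite [(l * j)%N]mulnC -muln_modr l1 muln_modr muln1.
(* If [p] does not divide [al - 1], then [al ^ j = 1] modulo [n] puts one factor [p] too many into
   [gsum al j], against [npl]. *)
have [pa|npa] := boolP (p %| al.-1)%N; last first.
  case/negP: npl; rewrite -(@Gauss_dvdl _ _ w) // -(@dvdn_pmul2r (p ^ k)) //.
  rewrite -mulnA -ej -expnS -el.
  apply: dvdn_gsum_coprime; rewrite ?coprimeXl ?prime_coprime //.
  apply: (eqmod_dvdn pk_n); apply: (pow_al_order_comm relA).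
  by rewrite Cj1 group1.
have [p2|p_odd] := even_prime p_pr.
  by rewrite p2 modn2; move: npl; rewrite p2 dvdn2 negbK => ->.
have := gsum_pfactor k w p_pr p_odd al_gt0 (pred_mod1 al_gt0 pa).
rewrite [(p ^ k * w)%N]mulnC -ej el => e.
have /eqP : (p ^ k * (l * w %% p) = p ^ k * (w %% p))%N.
  by rewrite !muln_modr -expnSr mulnCA [(p ^ k * w)%N]mulnC -ej.
rewrite eqn_pmul2l // => e'.
have l_gt0 : (0 < l)%N by rewrite lt0n; apply: contraNneq npl => ->; rewrite dvdn0.
apply/eqP; rewrite eqn_mod_dvd // subn1 -(@Gauss_dvdl _ _ w) //.
by rewrite -subn1 mulnBl mul1n -eqn_mod_dvd // leq_pmull.
Qed.

End Central.

(** Since [q > r], it is prime to the order [r^(v-1) (r - 1)] of the unit group, so a Bezout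
    relation writes [y] as a power of [y ^ q]. *)
Lemma pow1_mod_prime r q y v : prime r -> prime q -> (r < q)%N -> (0 < v)%N ->
  (y ^ q = 1 %[mod r ^ v] -> y = 1 %[mod r ^ v])%N.
Proof.
move=> r_pr q_pr rq v_gt0 hy; have q_gt0 := prime_gt0 q_pr.
have cy : coprime y (r ^ v).
  rewrite -(coprime_pexpl _ _ q_gt0) /coprime -gcdn_modl hy gcdn_modl.
  exact: coprime1n.
have cq : coprime q (totient (r ^ v)).
  have r1 := prime_gt1 r_pr.
  rewrite totient_pfactor // coprimeMr; apply/andP; split.
    by rewrite prime_coprime // gtnNdvd //; lia.
  by rewrite coprimeXr // prime_coprime // gtnNdvd //; lia.
have [[s t] /= est] := coprimeP _ q_gt0 cq.
have e : (s * q = t * totient (r ^ v) + 1)%N by lia.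
have -> : (y = (y ^ totient (r ^ v)) ^ t * y %[mod r ^ v])%N.
  by rewrite -modnMml -modnXm (Euler_exp_totient cy) modnXm exp1n modnMml mul1n.
rewrite -expnM -expnSr mulnC -addn1 -e mulnC expnM.
by rewrite -modnXm hy modnXm exp1n.
Qed.

(** At primes below [p] this is [pow1_mod_prime]. At [p] itself, Fermat gives [a ^ w = 1] modulo [p]
    for the part [w] of [N] prime to [p], and the [p]-power left in [N / p] lifts this to modulus
    [p ^ logn p N]. *)
Lemma pow_divp_mod1 p N n a : prime p -> (0 < n)%N -> (0 < a)%N -> (0 < N)%N ->
  (forall r, r \in primes n -> (r <= p)%N) -> (0 < logn p n)%N ->
  (logn p n <= logn p N)%N ->
  (a ^ N = 1 %[mod n] -> a ^ (N %/ p) = 1 %[mod n])%N.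
Proof.
move=> p_pr n_gt0 a_gt0 N_gt0 maxp n_p nN ha.
have k_gt0 : (0 < logn p N)%N by apply: leq_trans nN.
have pN : (p %| N)%N.
  by move: k_gt0; rewrite logn_gt0 mem_primes => /and3P[].
have b_gt0 i : (0 < a ^ i)%N by rewrite expn_gt0 a_gt0.
apply/eqP; rewrite eqn_mod_dvd //; apply/dvdn_partP => // r rn.
have r_pr : prime r by move: rn; rewrite mem_primes => /andP[].
rewrite p_part -eqn_mod_dvd //; apply/eqP.
have v_gt0 : (0 < logn r n)%N by rewrite logn_gt0.
have haN : (a ^ N = 1 %[mod r ^ logn r n])%N.
  by apply: (eqmod_dvdn _ ha); apply: pfactor_dvdnn.
have [ltrp|lepr] := ltnP r p.
  by apply: (pow1_mod_prime r_pr p_pr ltrp v_gt0); rewrite -expnM divnK.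
have {lepr}erp : r = p by apply/eqP; rewrite eqn_leq lepr maxp.
rewrite {r rn r_pr v_gt0 haN}erp.
have [w _ eN] := pfactor_coprime p_pr N_gt0.
have fermat z i : (z ^ (p ^ i) = z %[mod p])%N.
  elim: i => [|i IHi]; first by rewrite expn1.
  by rewrite expnSr expnM fermat_little.
have haw : (a ^ w = 1 %[mod p])%N.
  rewrite -(fermat _ (logn p N)) -expnM -eN; apply: (eqmod_dvdn _ ha).
  by move: n_p; rewrite logn_gt0 mem_primes => /and3P[].
have -> : (N %/ p = w * p ^ (logn p N).-1)%N.
  by rewrite {1}eN -{1}(prednK k_gt0) expnSr mulnA mulnK ?prime_gt0.
rewrite expnM; apply: (@eqmod_dvdn _ (p ^ logn p N)); first exact: dvdn_exp2l.
by rewrite -{2 3}(prednK k_gt0); apply: pow1_mod_lift.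
Qed.

Lemma mem_center_gen2 (gT : finGroupType) (A B z : gT) :
  z \in <<[set A; B]>> -> z ^ A = z -> z ^ B = z -> z \in 'Z(<<[set A; B]>>).
Proof.
move=> zG zA zB; rewrite inE zG -sub_cent1 gen_subG; apply/subsetP=> y.
by case/set2P=> ->; rewrite cent1C; apply/cent1P/commgP/conjg_fixP.
Qed.

Section Nilpotent.

Variables (gT : finGroupType) (A B : gT) (al be : nat).
Hypotheses (relA : A ^ [~ A, B] = A ^+ al) (relB : B ^ [~ B, A] = B ^+ be).

(** If [C] is killed by [#[A] / p] or [#[B] / p], then [conj_expA_top] makes a power of [A] or [B]
    central. Otherwise [#[A]], [#[B]] and [#[C]] have the same [p]-part, and [pow_divp_mod1] makes
    [C ^ (#[C] / p)] central. *)
Lemma center_neq1 : <<[set A; B]>> != 1 -> 'Z(<<[set A; B]>>) != 1.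
Proof.
set G := <<_>>; set C := [~ A, B]; move=> ntG.
have AG : A \in G by rewrite mem_gen // !inE eqxx.
have BG : B \in G by rewrite mem_gen // !inE eqxx orbT.
have CG : C \in G by rewrite groupR.
have nt z : z \in G -> z ^ A = z -> z ^ B = z -> z != 1 -> 'Z(G) != 1.
  move=> zG zA zB; apply: contraNneq => Z1.
  by have := mem_center_gen2 zG zA zB; rewrite -/G Z1 => /set1P->.
have ntop (x : gT) p : prime p -> (p %| #[x])%N -> x ^+ (#[x] %/ p) != 1.
  move=> p_pr px; rewrite -order_dvdn; apply/negP => /dvdn_leq.
  rewrite divn_gt0 ?prime_gt0 // dvdn_leq // => /(_ isT).
  by rewrite leqNgt ltn_Pdiv // prime_gt1.
have invC : [~ B, A] = C^-1 by rewrite invg_comm.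
have cA := comm_pow_order relA; have := comm_pow_order relB.
rewrite invC expgVn => /eqP; rewrite invg_eq1 => /eqP cB.
have AB_gt1 : (1 < #[A] * #[B])%N.
  rewrite ltn_neqAle muln_gt0 !order_gt0 !andbT eq_sym muln_eq1 !order_eq1.
  apply: contraNN ntG => /andP[/eqP A1 /eqP B1].
  by rewrite /G A1 B1 setUid -/(cycle 1) cycle1.
have := max_pdiv_prime AB_gt1; set p := max_pdiv _ => p_pr.
have maxA r : r \in primes #[A] -> (r <= p)%N.
  rewrite mem_primes => /and3P[r_pr _ rA]; apply: max_pdiv_max.
  by rewrite mem_primes r_pr muln_gt0 !order_gt0 dvdn_mulr.
have maxB r : r \in primes #[B] -> (r <= p)%N.
  rewrite mem_primes => /and3P[r_pr _ rB]; apply: max_pdiv_max.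
  by rewrite mem_primes r_pr muln_gt0 !order_gt0 dvdn_mull.
have caseA : (p %| #[A])%N -> C ^+ (#[A] %/ p) = 1 -> 'Z(G) != 1.
  move=> pA C1; apply: (nt (A ^+ (#[A] %/ p))); rewrite ?groupX ?ntop //.
    by rewrite conjXg conjgE mulKg.
  exact: conj_expA_top relA p_pr pA C1.
have caseB : (p %| #[B])%N -> C ^+ (#[B] %/ p) = 1 -> 'Z(G) != 1.
  move=> pB C1; apply: (nt (B ^+ (#[B] %/ p))); rewrite ?groupX ?ntop //.
    by apply: (conj_expA_top relB p_pr pB); rewrite invC expgVn C1 invg1.
  by rewrite conjXg conjgE mulKg.
have : (p %| #[A] * #[B])%N by apply: max_pdiv_dvd.
rewrite Euclid_dvdM // => pAB.
have lognC n : C ^+ n = 1 -> (0 < n)%N -> (p %| n)%N -> C ^+ (n %/ p) <> 1 ->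
    logn p #[C] = logn p n.
  move=> Cn n_gt0 pn Cnp.
  have /dvdnP[e en] : (#[C] %| n)%N by rewrite order_dvdn Cn.
  have e_gt0 : (0 < e)%N by move: n_gt0; rewrite en muln_gt0 => /andP[].
  have npe : ~~ (p %| e)%N.
    apply/negP => /dvdnP[f ef]; apply: Cnp.
    by rewrite en ef mulnAC mulnK ?prime_gt0 // mulnC expgM expg_order expg1n.
  by rewrite en lognM // (lognE p e) (negPf npe) !andbF.
(* When [p] divides only one of [#[A]] and [#[B]], the order of [C] is prime to [p], which leads
   back to [caseA] or [caseB]. *)
have drop n n' : C ^+ n = 1 -> C ^+ n' = 1 -> (p %| n)%N -> ~~ (p %| n')%N ->
    C ^+ (n %/ p) = 1.
  move=> Cn Cn' pn npn'; apply/eqP; rewrite -order_dvdn.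
  rewrite -(@Gauss_dvdl _ _ p); first by rewrite divnK // order_dvdn Cn.
  rewrite coprime_sym prime_coprime //; apply: contra npn' => /dvdn_trans.
  by apply; rewrite order_dvdn Cn'.
have [pA|npA] := boolP (p %| #[A])%N; last first.
  by move: pAB; rewrite (negPf npA) => pB; apply: caseB => //; apply: drop cB cA _ _.
have [pB|npB] := boolP (p %| #[B])%N; last first.
  by apply: caseA => //; apply: drop cA cB _ _.
have [CA|/eqP CA] := altP (C ^+ (#[A] %/ p) =P 1); first exact: caseA.
have [CB|/eqP CB] := altP (C ^+ (#[B] %/ p) =P 1); first exact: caseB.
have lA := lognC _ cA (order_gt0 _) pA CA.
have lB := lognC _ cB (order_gt0 _) pB CB.
have logp_gt0 (x : gT) : (p %| #[x])%N -> (0 < logn p #[x])%N.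
  by move=> px; rewrite logn_gt0 mem_primes p_pr order_gt0.
have pC : (p %| #[C])%N.
  by have := logp_gt0 _ pA; rewrite -lA logn_gt0 mem_primes => /and3P[].
have base_gt0 (x y : gT) e : (p %| #[x])%N -> x ^ y = x ^+ e -> (0 < e)%N.
  move=> px; case: e => // /eqP; rewrite expg0 conjg_eq1 => /eqP x1.
  by move: px; rewrite x1 order1 dvdn1 => /eqP p1; move: p_pr; rewrite p1.
have comm (x y : gT) e : x ^ [~ x, y] = x ^+ e -> [~ x, y] ^+ #[C] = 1 ->
    (p %| #[x])%N -> logn p #[C] = logn p #[x] ->
    (forall r, r \in primes #[x] -> (r <= p)%N) ->
    x ^ ([~ x, y] ^+ (#[C] %/ p)) = x.
  move=> rel C1 px lx maxx; rewrite -[in LHS](expg1 x) (conj_relA rel) mul1n.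
  apply/eqP; rewrite -[X in _ == X]expg1 eq_expg_mod_order; apply/eqP.
  apply: pow_divp_mod1; rewrite ?order_gt0 ?logp_gt0 ?lx //.
    exact: base_gt0 px rel.
  by apply: (pow_al_order_comm rel); rewrite C1 group1.
apply: (nt (C ^+ (#[C] %/ p))); rewrite ?groupX ?ntop //.
  have := comm A B _ relA (expg_order _) pA lA maxA.
  by move/conjg_fixP/commgP => cAC; apply/conjg_fixP/commgP/commute_sym.
have := comm B A _ relB; rewrite invC !expgVn expg_order invg1.
move=> /(_ erefl pB lB maxB) /conjg_fixP/commgP /commuteV; rewrite invgK => cBC.
by apply/conjg_fixP/commgP/commute_sym.
Qed.

End Nilpotent.

(** The quotient by the centre satisfies the same relations with the same exponents, so induction on
    the order applies. *)
Lemma rels_nilpotent (gT : finGroupType) (A B : gT) (al be : nat) :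
  A ^ [~ A, B] = A ^+ al -> B ^ [~ B, A] = B ^+ be -> nilpotent <<[set A; B]>>.
Proof.
have [n] := ubnP #|<<[set A; B]>>|; elim: n => // n IHn in gT A B *.
rewrite ltnS => leGn relA relB.
have [->|ntG] := eqVneq <<[set A; B]>> 1; first exact: nilpotent1.
have ntZ := center_neq1 relA relB ntG.
rewrite -quotient_center_nil; set Z := 'Z(_) in ntZ *.
have nZ : <<[set A; B]>> \subset 'N(Z) by apply/normal_norm/center_normal.
have nZA : A \in 'N(Z) by apply: (subsetP nZ); rewrite mem_gen // !inE eqxx.
have nZB : B \in 'N(Z) by apply: (subsetP nZ); rewrite mem_gen // !inE eqxx orbT.
have eG : <<[set A; B]>> / Z = <<[set coset Z A; coset Z B]>>.
  have sAB : [set A; B] \subset 'N(Z) by rewrite subUset !sub1set nZA nZB.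
  by rewrite quotient_gen // quotientU !quotient_set1.
rewrite eG; apply: IHn.
- by rewrite -eG (leq_trans _ leGn) // ltn_quotient // center_sub.
- by rewrite -morphR //= -morphJ ?groupR //= relA morphX.
by rewrite -morphR //= -morphJ ?groupR //= relB morphX.
Qed.

(** * A permutation model of order at least [2 ^ (7m - 3)] *)

Section Model.

Local Open Scope ring_scope.

(** * Binomial expansions modulo [4 h^3] *)

Lemma bin2Z n : 2 * 'C(n, 2)%:Z = n%:Z * (n%:Z - 1).
Proof. by elim: n => [|n IHn] //; rewrite binS bin1 PoszD mulrDr IHn; ring. Qed.

Lemma bin3Z n : 6 * 'C(n, 3)%:Z = n%:Z * (n%:Z - 1) * (n%:Z - 2).
Proof.
elim: n => [|n IHn] //; rewrite binS PoszD mulrDr IHn.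
have -> : (6 * 'C(n, 2)%:Z = 3 * (2 * 'C(n, 2)%:Z)) by ring.
by rewrite bin2Z; ring.
Qed.

Let SZ (n : nat) : n.+1%:Z = n%:Z + 1.
Proof. by rewrite -addn1 PoszD. Qed.

Let bin2SE (n : nat) : 'C(n.+1, 2)%:Z = 'C(n, 2)%:Z + n%:Z.
Proof. by rewrite binS bin1 PoszD. Qed.

Let bin3SE (n : nat) : 'C(n.+1, 3)%:Z = 'C(n, 3)%:Z + 'C(n, 2)%:Z.
Proof. by rewrite binS PoszD. Qed.

Variables (k u v d h al be : nat).
Hypotheses (v_odd : odd v) (hE : h = (2 ^ k.+1)%N).
Hypotheses (al_eq : al = (2 * h * u).+1) (be_eq : be = (2 * h * v).+1).
Hypothesis al_be : al = (be + 4 * h ^ 2 * d)%N.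

Let H : int := h%:Z.
Let U : int := u%:Z.
Let V : int := v%:Z.
Let M : int := 4 * H ^+ 3.

Let alE : al%:Z = 1 + 2 * H * U. Proof. by rewrite al_eq /H /U; lia. Qed.
Let beE : be%:Z = 1 + 2 * H * V. Proof. by rewrite be_eq /H /V; lia. Qed.

Let HE : exists g : int, H = 2 * g.
Proof. by exists (2 ^ k)%N%:Z; rewrite /H hE expnS PoszM. Qed.

Let dvd3 (x y : int) : 3 * x = H * y -> exists z, x = H * z.
Proof.
move=> e; have: (H %| 3 * x)%Z by rewrite e dvdz_mulr.
rewrite Gauss_dvdzr; first by case/dvdzP=> z ->; exists z; rewrite mulrC.
by rewrite coprimezE /H hE /= coprimeXl.
Qed.

(** Summing the binomial expansions of [(1 + 2 H V)^i] by the hockey-stick identity gives the terms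
    [(2 H V)^r 'C(j + 1, r + 1)]; those with [r >= 3] vanish modulo [8 H^3 = 2 M]. *)
Lemma gsum_mod (j : nat) : exists z : int, (gsum be j)%:Z =
  j%:Z + 2 * H * V * 'C(j.+1, 2)%:Z + 4 * H ^+ 2 * V ^+ 2 * 'C(j.+1, 3)%:Z + 2 * M * z.
Proof.
elim: j => [|j [z IHj]]; first by exists 0; rewrite !bin_small // /gsum /=; ring.
rewrite gsumS PoszM SZ IHj beE.
exists (z + 2 * H * V * z + V ^+ 3 * 'C(j.+1, 3)%:Z).
rewrite (bin2SE j.+1) (bin3SE j.+1) (SZ j) /M; ring.
Qed.

(** Three times the difference is a multiple of [H], and 3 is prime to the power of two [H]. *)
Lemma bin3_cong (x y : nat) (w : int) : x%:Z = y%:Z + 2 * H * w ->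
  exists z : int, 'C(x.+1, 3)%:Z = 'C(y.+1, 3)%:Z + H * z.
Proof.
move=> e; have := bin3Z x.+1; have := bin3Z y.+1.
rewrite !SZ e => ey ex.
have [z ez] : exists z, 'C(x.+1, 3)%:Z - 'C(y.+1, 3)%:Z = H * z.
  apply: (dvd3 (y := w * (3 * y%:Z ^+ 2 + 6 * H * w * y%:Z + 4 * H ^+ 2 * w ^+ 2 - 1))).
  apply: (@mulfI _ 2) => //; move: ex ey.
  set X := 'C(x.+1, 3)%:Z; set Y := 'C(y.+1, 3)%:Z => ex ey.
  have -> : 2 * (3 * (X - Y)) = 6 * X - 6 * Y by ring.
  by rewrite ex ey; ring.
by exists z; rewrite -ez; ring.
Qed.

(** The exponent of [y] after [s] right multiplications by [x] in the model below. *)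
Definition iterg s j := iter s (gsum be) j.

Lemma iterg_mod (j s : nat) : exists z : int, (iterg s j)%:Z =
  j%:Z + 2 * H * V * s%:Z * 'C(j.+1, 2)%:Z + 4 * H ^+ 2 * V ^+ 2 * s%:Z * 'C(j.+1, 3)%:Z
  + 2 * H ^+ 2 * V ^+ 2 * 'C(s, 2)%:Z * (2 * j%:Z + 1) * 'C(j.+1, 2)%:Z
  + 2 * H ^+ 3 * V ^+ 3 * 'C(s, 3)%:Z * (2 * j%:Z + 1) ^+ 2 * 'C(j.+1, 2)%:Z + M * z.
Proof.
elim: s => [|s [z IHs]].
  by exists 0; rewrite !bin0n /iterg /=; ring.
rewrite /iterg iterS -/(iterg s j); set n := iterg s j in IHs *.
have [t ->] := gsum_mod n.
set P := 'C(j.+1, 2)%:Z in IHs *; set Q := 'C(j.+1, 3)%:Z in IHs *.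
have eP : 2 * P = (j%:Z + 1) * j%:Z by rewrite bin2Z SZ; ring.
have en : 2 * 'C(n.+1, 2)%:Z = (n%:Z + 1) * n%:Z by rewrite bin2Z SZ; ring.
have [r er] : exists r, 'C(n.+1, 3)%:Z = Q + H * r.
  apply: (bin3_cong (w := V * s%:Z * P + 2 * H * V ^+ 2 * s%:Z * Q
    + H * V ^+ 2 * 'C(s, 2)%:Z * (2 * j%:Z + 1) * P
    + H ^+ 2 * V ^+ 3 * 'C(s, 3)%:Z * (2 * j%:Z + 1) ^+ 2 * P + 2 * H ^+ 2 * z)).
  by rewrite IHs /M; ring.
have -> : 2 * H * V * 'C(n.+1, 2)%:Z = H * V * ((n%:Z + 1) * n%:Z).
  by rewrite -en; ring.
rewrite er (bin2SE s) (bin3SE s) (SZ s).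
have [g eg] := HE.
set c2 := 'C(s, 2)%:Z in IHs *; set c3 := 'C(s, 3)%:Z in IHs *.
set J := j%:Z in IHs eP *; set S := s%:Z in IHs *.
pose D1 := V * S * P + 2 * H * V ^+ 2 * S * Q + H * V ^+ 2 * c2 * (2 * J + 1) * P
    + H ^+ 2 * V ^+ 3 * c3 * (2 * J + 1) ^+ 2 * P + 2 * H ^+ 2 * z.
have eD : n%:Z = J + 2 * H * D1 by rewrite IHs /M /D1; ring.
have -> : (n%:Z + 1) * n%:Z = 2 * P + 2 * H * D1 * (2 * J + 1) + 4 * H ^+ 2 * D1 ^+ 2.
  by rewrite eP eD; ring.
exists (z + 2 * t + V ^+ 2 * r + V * D1 ^+ 2 + V * (2 * J + 1) * (V ^+ 2 * S * Q + H * z)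
   + g * V ^+ 4 * c3 * (2 * J + 1) ^+ 3 * P).
rewrite {1}IHs /D1 /M.
(* The [H^4] term in [c3] has only one explicit factor 2; [H = 2 g] supplies the second, making it a
   multiple of [M]. *)
have -> : H ^+ 2 * V ^+ 3 * c3 * (2 * J + 1) ^+ 2 * P
    = H * (2 * g) * V ^+ 3 * c3 * (2 * J + 1) ^+ 2 * P.
  by rewrite -eg; ring.
ring.
Qed.

Let c2E : 'C(al, 2)%:Z = al%:Z * H * U.
Proof. by apply: (@mulfI _ 2) => //; rewrite bin2Z {2}alE; ring. Qed.

Let c3E : exists w, 'C(al, 3)%:Z = H * w.
Proof.
apply: (dvd3 (y := al%:Z * U * (2 * H * U - 1))); apply: (@mulfI _ 2) => //.
have -> : 2 * (3 * 'C(al, 3)%:Z) = 6 * 'C(al, 3)%:Z by ring.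
by rewrite bin3Z {2 3}alE; ring.
Qed.

Lemma iterg_al_mod (j : nat) : exists z : int, (iterg al j)%:Z =
  j%:Z + 2 * H * V * al%:Z * 'C(j.+1, 2)%:Z + 4 * H ^+ 2 * V ^+ 2 * al%:Z * 'C(j.+1, 3)%:Z
  + 2 * H ^+ 3 * V ^+ 2 * al%:Z * U * (2 * j%:Z + 1) * 'C(j.+1, 2)%:Z + M * z.
Proof.
have [z ->] := iterg_mod j al; have [w ->] := c3E; rewrite c2E; have [g eg] := HE.
exists (z + g * V ^+ 3 * w * (2 * j%:Z + 1) ^+ 2 * 'C(j.+1, 2)%:Z).
by rewrite /M eg; ring.
Qed.

(** The exponent of [[y, x]] gained in [s] right multiplications by [x]. *)
Definition sumg s j := (\sum_(t < s) iterg t j)%N.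

Lemma sumgS s j : sumg s.+1 j = (sumg s j + iterg s j)%N.
Proof. by rewrite /sumg big_ord_recr. Qed.

Lemma sumg_mod (j s : nat) : exists z : int, (sumg s j)%:Z =
  s%:Z * j%:Z + 2 * H * V * 'C(s, 2)%:Z * 'C(j.+1, 2)%:Z
  + 2 * H ^+ 2 * V ^+ 2 * 'C(s, 3)%:Z * (2 * j%:Z + 1) * 'C(j.+1, 2)%:Z
  + 4 * H ^+ 2 * z.
Proof.
elim: s => [|s [z IHs]]; first by exists 0; rewrite /sumg big_ord0 !bin0n /=; ring.
rewrite sumgS PoszD IHs; have [w ->] := iterg_mod j s; have [g eg] := HE.
rewrite (bin2SE s) (bin3SE s) (SZ s).
exists (z + V ^+ 2 * s%:Z * 'C(j.+1, 3)%:Z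
  + g * V ^+ 3 * 'C(s, 3)%:Z * (2 * j%:Z + 1) ^+ 2 * 'C(j.+1, 2)%:Z + H * w).
by rewrite /M eg; ring.
Qed.

Lemma sumg_al_mod (j : nat) : exists z : int, (sumg al j)%:Z =
  al%:Z * j%:Z + 2 * H ^+ 2 * V * U * al%:Z * 'C(j.+1, 2)%:Z + 4 * H ^+ 2 * z.
Proof.
have [z ->] := sumg_mod j al; have [w ->] := c3E; rewrite c2E; have [g eg] := HE.
exists (z + V ^+ 2 * g * w * (2 * j%:Z + 1) * 'C(j.+1, 2)%:Z).
by rewrite eg; ring.
Qed.

Lemma exp_al_mod n : exists z : int, (al ^ n)%N%:Z =
  1 + 2 * H * U * n%:Z + 4 * H ^+ 2 * U ^+ 2 * 'C(n, 2)%:Z + 2 * M * z.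
Proof.
elim: n => [|n [z IHn]]; first by exists 0; rewrite expn0 bin0n /=; ring.
rewrite expnS PoszM IHn {1}alE (bin2SE n) (SZ n).
exists (z + 2 * H * U * z + U ^+ 3 * 'C(n, 2)%:Z); rewrite /M; ring.
Qed.

(** An [x] that moves left across [[y, x]^k] becomes [x ^ (al ^ k)]; the sum collects these
    exponents over [s] multiplications by [x], during which [k] grows by [sumg t j]. *)
Lemma exp_sumg_mod (j s : nat) : exists z : int,
  (\sum_(t < s) al ^ sumg t j)%N%:Z =
  s%:Z + 2 * H * U * (j%:Z * 'C(s, 2)%:Z + 2 * H * V * 'C(s, 3)%:Z * 'C(j.+1, 2)%:Z)
  + 4 * H ^+ 2 * U ^+ 2 * (j%:Z ^+ 2 * 'C(s, 3)%:Z + 'C(s, 2)%:Z * 'C(j, 2)%:Z) + M * z.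
Proof.
elim: s => [|s [z IHs]]; first by exists 0; rewrite big_ord0 !bin0n /=; ring.
rewrite big_ord_recr /= PoszD IHs.
have [w ew] := sumg_mod j s; have [t ->] := exp_al_mod (sumg s j).
pose X := V * 'C(s, 2)%:Z * 'C(j.+1, 2)%:Z
  + H * V ^+ 2 * 'C(s, 3)%:Z * (2 * j%:Z + 1) * 'C(j.+1, 2)%:Z + 2 * H * w.
have eX : (sumg s j)%:Z = s%:Z * j%:Z + 2 * H * X by rewrite ew /X; ring.
have -> : 'C(sumg s j, 2)%:Z = j%:Z ^+ 2 * 'C(s, 2)%:Z + s%:Z * 'C(j, 2)%:Z
    + H * X * ((sumg s j)%:Z + s%:Z * j%:Z - 1).
  apply: (@mulfI _ 2) => //; rewrite bin2Z.
  have -> : forall a b c e f : int, 2 * (a * b + c * e + f) = a * (2 * b) + c * (2 * e) + 2 * f.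
    by move=> *; ring.
  by rewrite !bin2Z eX; ring.
rewrite (bin2SE s) (bin3SE s) (SZ s).
exists (z + 2 * t + U * V ^+ 2 * 'C(s, 3)%:Z * (2 * j%:Z + 1) * 'C(j.+1, 2)%:Z
  + 2 * U * w + U ^+ 2 * X * ((sumg s j)%:Z + s%:Z * j%:Z - 1)).
by rewrite ew /X /M; ring.
Qed.

Lemma bin2SZ (n : nat) : 2 * 'C(n.+1, 2)%:Z = (n%:Z + 1) * n%:Z.
Proof. by rewrite bin2Z SZ; ring. Qed.

Let bej_mod (j : nat) : exists z : int, (gsum be (be * j))%:Z =
  be%:Z * j%:Z + H * V * (be%:Z * j%:Z + 1) * (be%:Z * j%:Z)
  + 4 * H ^+ 2 * V ^+ 2 * 'C(j.+1, 3)%:Z + M * z.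
Proof.
have [w ->] := gsum_mod (be * j).
have [r ->] : exists r, 'C((be * j).+1, 3)%:Z = 'C(j.+1, 3)%:Z + H * r.
  by apply: (bin3_cong (w := V * j%:Z)); rewrite PoszM beE; ring.
exists (2 * w + V ^+ 2 * r).
have -> : 2 * H * V * 'C((be * j).+1, 2)%:Z = H * V * (2 * 'C((be * j).+1, 2)%:Z).
  by ring.
by rewrite bin2SZ PoszM /M; ring.
Qed.

Let UE : U = V + 2 * H * d%:Z.
Proof.
have : 2 * H * U = 2 * H * (V + 2 * H * d%:Z).
  apply: (addrI 1); rewrite -alE al_be PoszD beE /H !PoszM; ring.
by apply: mulfI; rewrite /H hE mulf_neq0 // eqz_nat expn_eq0.
Qed.

(** Third coordinate of the relation [x ^ [x, y] = x ^ al] in the model; [sumg_comm_mod] is the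
    second one. Both matter only modulo [2 h^2]. *)
Lemma iterg_comm_mod (j : nat) : exists z : int,
  (gsum be (be * j))%:Z = (be * iterg al j)%N%:Z + 2 * H ^+ 2 * z.
Proof.
have [z eZ] := iterg_al_mod j; have [w ->] := bej_mod j; rewrite PoszM eZ.
have := bin2SZ j; set P := 'C(j.+1, 2)%:Z => eP.
exists (V ^+ 2 * be%:Z * j%:Z ^+ 2 + 2 * V ^+ 2 * 'C(j.+1, 3)%:Z * (1 - be%:Z * al%:Z) + 2 * H * w
  - H * V ^+ 2 * al%:Z * be%:Z * U * (2 * j%:Z + 1) * P - 2 * H * z * be%:Z
  - U * V * be%:Z * (j%:Z + 1) * j%:Z).
have -> : be%:Z * (j%:Z + 2 * H * V * al%:Z * P +
   4 * H ^+ 2 * V ^+ 2 * al%:Z * 'C(j.+1, 3)%:Z +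
   2 * H ^+ 3 * V ^+ 2 * al%:Z * U * (2 * j%:Z + 1) * P + M * z) =
   be%:Z * (j%:Z + H * V * al%:Z * ((j%:Z + 1) * j%:Z) +
   4 * H ^+ 2 * V ^+ 2 * al%:Z * 'C(j.+1, 3)%:Z +
   2 * H ^+ 3 * V ^+ 2 * al%:Z * U * (2 * j%:Z + 1) * P + M * z).
  by rewrite -eP; ring.
by rewrite alE beE /M; ring.
Qed.

Lemma sumg_comm_mod (j : nat) : exists z : int,
  (be * j)%N%:Z = (sumg al j)%:Z + 2 * H ^+ 2 * z.
Proof.
have [z ->] := sumg_al_mod j; rewrite PoszM.
exists (- 2 * d%:Z * j%:Z - U * V * al%:Z * 'C(j.+1, 2)%:Z - 2 * z).
by rewrite al_be PoszD beE /H !PoszM; ring.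
Qed.

(* First coordinate of the relation [x ^ [x, y] = x ^ al] in the model. *)
Lemma relator_mod (n j : nat) : exists z : int,
  (al ^ n)%N%:Z * ((\sum_(t < al) al ^ sumg t j)%N%:Z - al%:Z) =
  be%:Z * (iterg al j)%:Z - (gsum be (be * j))%:Z
  + H * (be%:Z * j%:Z - (sumg al j)%:Z) + M * z.
Proof.
have [z1 ->] := exp_al_mod n; have [z2 ->] := exp_sumg_mod j al.
have [z3 ->] := iterg_al_mod j; have [z4 ->] := bej_mod j.
have [z5 ->] := sumg_al_mod j; have [w ->] := c3E; rewrite c2E.
have := bin2SZ j; set P := 'C(j.+1, 2)%:Z => eP.
set Q := 'C(j.+1, 3)%:Z; set J := j%:Z in eP *.
set R := 'C(j, 2)%:Z; set N := n%:Z; set C := 'C(n, 2)%:Z.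
(* The right-hand side contains [2 H^3 U V al P (V be (2 J + 1) - 1)]; since [V] is odd the last
   factor is even, so this is a multiple of [M]. *)
have [v' ev] : exists v', V = 2 * v' + 1.
  by exists (v./2)%:Z; rewrite /V -{1}(odd_double_half v) v_odd; lia.
pose s1 := U * V * w * P + U ^+ 2 * J ^+ 2 * w + al%:Z * U ^+ 3 * R + z2.
pose a1 := U * N + 2 * H * U ^+ 2 * C + 4 * H ^+ 2 * z1.
pose zl := U ^+ 3 * J + a1 * U ^+ 2 * al%:Z * J + (1 + 2 * H * a1) * s1.
pose zr := V * be%:Z * d%:Z * J ^+ 2 + U * V ^+ 2 * J - U * d%:Z * J
  + 2 * V ^+ 2 * Q * (U + V + 2 * H * U * V)
  + V * U * al%:Z * P * (v' * be%:Z * (2 * J + 1) + J + H * V * (2 * J + 1))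
  - d%:Z * J - z5 + be%:Z * z3 - z4.
exists (zl - zr).
have -> : (1 + 2 * H * U * N + 4 * H ^+ 2 * U ^+ 2 * C + 2 * M * z1)
    * (al%:Z + 2 * H * U * (J * (al%:Z * H * U) + 2 * H * V * (H * w) * P)
      + 4 * H ^+ 2 * U ^+ 2 * (J ^+ 2 * (H * w) + al%:Z * H * U * R) + M * z2 - al%:Z)
    = 2 * H ^+ 2 * U ^+ 2 * J + M * zl.
  by rewrite /zl /a1 /s1 /M alE; ring.
apply: (addIr (- (M * zl))); rewrite addrK.
apply/eqP; rewrite -subr_eq0; apply/eqP.
(* Treating [P] as a free variable, the two sides differ by this multiple of [2 P - (J + 1) J],
   which vanishes by [eP]. *)
transitivity (- be%:Z * H * V * al%:Z * (2 * P - (J + 1) * J)); last first.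
  by rewrite eP subrr mulr0.
rewrite /zr /M alE beE UE ev; ring.
Qed.

(** * The permutations and their relations *)

Let Mn := (4 * h ^ 3)%N.
Let qn := (2 * h ^ 2)%N.
Let K := Mn.-1.

Let h_gt0 : (0 < h)%N. Proof. by rewrite hE expn_gt0. Qed.
Let MnE : Mn%:Z = M. Proof. by rewrite /M /H /Mn !PoszM; ring. Qed.
Let qnE : qn%:Z = 2 * H ^+ 2. Proof. by rewrite /H /qn !PoszM; ring. Qed.
Let KE : K%:Z = M - 1.
Proof.
have : (0 < Mn)%N by rewrite /Mn muln_gt0 expn_gt0 h_gt0.
by rewrite -MnE /K; lia.
Qed.

Lemma eqmodnZ (x y n : nat) :
  (x = y %[mod n])%N <-> exists z : int, x%:Z = y%:Z + n%:Z * z.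
Proof.
split=> [e|[z e]].
  exists ((x %/ n)%N%:Z - (y %/ n)%N%:Z).
  rewrite {1}(divn_eq x n) {1}(divn_eq y n) e !PoszD !PoszM; ring.
by apply/eqP; rewrite -eqz_nat -!modz_nat e addrC mulrC modzMDl.
Qed.

(* Right multiplication by [x], [y] and [[y, x]] on the normal form [x^i [y,x]^k y^j], in
   the coordinates [(i - j + h k, k, j)].  These absorb the identifications
   [y^qn = x^-qn] and [[y,x]^qn = x^(2 h^3)], so that a triple only matters modulo
   [(Mn, qn, qn)]; [K] stands for [-1]. *)
Definition stepx (p : nat * nat * nat) := ((p.1.1 + al ^ p.1.2 + K * gsum be p.2
  + (p.2 + h * p.2))%N, (p.1.2 + p.2)%N, gsum be p.2).
Definition stepy (p : nat * nat * nat) := ((p.1.1 + K)%N, p.1.2, p.2.+1).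
Definition stepd (p : nat * nat * nat) :=
  ((p.1.1 + K * (be.-1 * p.2) + h)%N, p.1.2.+1, (be * p.2)%N).

Definition eqp (p p' : nat * nat * nat) := [/\ (p.1.1 = p'.1.1 %[mod Mn])%N,
  (p.1.2 = p'.1.2 %[mod qn])%N & (p.2 = p'.2 %[mod qn])%N].

Let PoszX (x n : nat) : (x ^ n)%N%:Z = x%:Z ^+ n.
Proof. by elim: n => [|n IHn]; rewrite ?expnS ?exprS ?PoszM ?IHn. Qed.

Let be1E : be.-1%:Z = 2 * H * V.
Proof. by rewrite be_eq /H /V !PoszM. Qed.

Lemma exp_al_eqmod (i i' : nat) :
  (i = i' %[mod qn])%N -> (al ^ i = al ^ i' %[mod Mn])%N.
Proof.
move/eqmodnZ=> [w]; rewrite qnE => e; apply/eqmodnZ; rewrite MnE.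
have [z ->] := exp_al_mod i; have [z' ->] := exp_al_mod i'.
have -> : 'C(i, 2)%:Z = 'C(i', 2)%:Z + H ^+ 2 * w * (i%:Z + i'%:Z - 1).
  by apply: (@mulfI _ 2) => //; rewrite mulrDr !bin2Z e; ring.
exists (U * w + H * U ^+ 2 * w * (i%:Z + i'%:Z - 1) + 2 * z - 2 * z').
by rewrite e /M; ring.
Qed.

Let V_odd : exists v', V = 2 * v' + 1.
Proof. by exists (v./2)%:Z; rewrite /V -{1}(odd_double_half v) v_odd; lia. Qed.

Let gsum_mod' (j : nat) : exists z : int, (gsum be j)%:Z =
  j%:Z + H * V * ((j%:Z + 1) * j%:Z) + 4 * H ^+ 2 * V ^+ 2 * 'C(j.+1, 3)%:Z + M * z.
Proof. by have [z ->] := gsum_mod j; exists (2 * z); rewrite -bin2SZ; ring. Qed.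

(** Shifting [j] by [2 h^2 w] changes [j - gsum be j] by [-2 h^3 v w (2 j' + 1)] modulo [4 h^3], and
    [h j] by [2 h^3 w]. As [v] is odd the two changes cancel, so [stepx] is well defined. *)
Lemma gsum_eqmod (j j' : nat) : (j = j' %[mod qn])%N ->
  (gsum be j = gsum be j' %[mod qn])%N /\
  (K * gsum be j + (j + h * j) = K * gsum be j' + (j' + h * j') %[mod Mn])%N.
Proof.
move/eqmodnZ=> [w]; rewrite qnE => e; have [v' ev] := V_odd.
have [z eZ] := gsum_mod' j; have [z' eZ'] := gsum_mod' j'.
have [r er] : exists r, 'C(j.+1, 3)%:Z = 'C(j'.+1, 3)%:Z + H * r.
  by apply: (bin3_cong (w := H * w)); rewrite e; ring.
split; apply/eqmodnZ.
  rewrite qnE eZ eZ' er e.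
  exists (w + H * V * w * (2 * j'%:Z + 1 + 2 * H ^+ 2 * w) + 2 * H * V ^+ 2 * r
    + 2 * H * z - 2 * H * z').
  by rewrite /M; ring.
exists ((gsum be j)%:Z - (gsum be j')%:Z - V ^+ 2 * r - (z - z') - H ^+ 2 * V * w ^+ 2
  - w * (v' * (2 * j'%:Z + 1) + j'%:Z)).
rewrite MnE !PoszD !PoszM KE -/H eZ eZ' er e /M ev; ring.
Qed.

Let eqmodD n a a' b b' : (a = a' %[mod n] -> b = b' %[mod n] ->
  a + b = a' + b' %[mod n])%N.
Proof. by move=> ea eb; rewrite -modnDm ea eb modnDm. Qed.

Lemma stepx_eqp p p' : eqp p p' -> eqp (stepx p) (stepx p').
Proof.
case: p p' => [[I k'] j] [[I' k''] j'] [/= eI ek ej].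
have [eg eKg] := gsum_eqmod ej; split=> //=; last exact: eqmodD.
by rewrite -(addnA (I + _)) -(addnA (I' + _)); apply: eqmodD eKg; apply: eqmodD (exp_al_eqmod ek).
Qed.

Lemma stepy_eqp p p' : eqp p p' -> eqp (stepy p) (stepy p').
Proof.
case: p p' => [[I k'] j] [[I' k''] j'] [/= eI ek ej]; split=> //=.
  by rewrite -modnDml eI modnDml.
by rewrite -[j.+1]addn1 -[j'.+1]addn1 -modnDml ej modnDml.
Qed.

Lemma stepd_eqp p p' : eqp p p' -> eqp (stepd p) (stepd p').
Proof.
case: p p' => [[I k'] j] [[I' k''] j'] [/= /eqmodnZ[x ex] /eqmodnZ[y ey] /eqmodnZ[z ez]].
rewrite MnE in ex; rewrite qnE in ey ez; split=> /=; apply/eqmodnZ; rewrite ?MnE ?qnE.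
- exists (x + K%:Z * V * z); rewrite !PoszD !PoszM be1E ex ez /M; ring.
- by exists y; rewrite !SZ ey; ring.
by exists (be%:Z * z); rewrite !PoszM ez; ring.
Qed.

(** The third coordinate comes first: the difference [D] satisfies [D (1 + H f) = 0] modulo [2 H^2].
    Multiplying by [1 - H f] leaves [D = D H^2 f^2], which vanishes because [D] is even. *)
Lemma stepx_inj p p' : eqp (stepx p) (stepx p') -> eqp p p'.
Proof.
case: p p' => [[I k'] j] [[I' k''] j'] [/= eI ek ej].
have {}ej : (j = j' %[mod qn])%N.
  move: ej => /eqmodnZ[t]; rewrite qnE => et; apply/eqmodnZ; rewrite qnE.
  have [z eZ] := gsum_mod' j; have [z' eZ'] := gsum_mod' j'; have [g eg] := HE.
  pose D := j%:Z - j'%:Z; pose f := V * (j%:Z + j'%:Z + 1).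
  pose t' := t + 2 * V ^+ 2 * ('C(j'.+1, 3)%:Z - 'C(j.+1, 3)%:Z) + 2 * H * (z' - z).
  have eD : D * (1 + H * f) = 2 * H ^+ 2 * t'.
    apply/eqP; rewrite -subr_eq0; apply/eqP.
    transitivity ((gsum be j)%:Z - (gsum be j')%:Z - 2 * H ^+ 2 * t).
      by rewrite eZ eZ' /t' /D /f /M; ring.
    by rewrite et; ring.
  pose D2 := H ^+ 2 * t' - D * g * f.
  have eD2 : D = 2 * D2.
    transitivity (D * (1 + H * f) - D * (H * f)); first by ring.
    by rewrite eD /D2 [X in D * (X * f)]eg; ring.
  exists (D2 * f ^+ 2 + t' * (1 - H * f)).
  have -> : j%:Z = j'%:Z + D by rewrite /D; ring.
  congr (_ + _).
  transitivity (D * H ^+ 2 * f ^+ 2 + D * (1 + H * f) * (1 - H * f)); first by ring.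
  by rewrite eD {1}eD2; ring.
have [_ eKg] := gsum_eqmod ej.
have {}ek : (k' = k'' %[mod qn])%N.
  by apply/eqP; rewrite -(eqn_modDr j) -[X in _ == X]modnDmr ej modnDmr ek.
split=> //=; apply/eqP; move: eI.
rewrite -!(addnA (_ + _)) -!(addnA _ (al ^ _)%N) => /eqP.
rewrite -[in X in X == _]modnDmr (eqmodD (exp_al_eqmod ek) eKg) modnDmr.
by rewrite eqn_modDr.
Qed.

Lemma iter_stepx s p : iter s stepx p = ((p.1.1 + al ^ p.1.2 * (\sum_(t < s) al ^ sumg t p.2)
  + K * (\sum_(t < s) iterg t.+1 p.2) + (sumg s p.2 + h * sumg s p.2))%N,
  (p.1.2 + sumg s p.2)%N, iterg s p.2).
Proof.
elim: s => [|s IHs].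
  by rewrite /sumg !big_ord0 /= !muln0 !addn0; case: p => [[]].
rewrite iterS IHs /stepx /=; congr (_, _, _).
  by rewrite !big_ord_recr /= sumgS expnD; ring.
by rewrite sumgS addnA.
Qed.

Lemma sum_itergS s j : (\sum_(t < s) iterg t.+1 j + j = sumg s j + iterg s j)%N.
Proof.
elim: s => [|s IHs]; first by rewrite /sumg !big_ord0.
by rewrite big_ord_recr sumgS /= addnAC; move: IHs => /= ->.
Qed.

(** The first relation in the form [[y, x] x = x ^ al [y, x]], with factors acting from left to
    right. *)
Lemma stepx_stepd p : eqp (stepx (stepd p)) (stepd (iter al stepx p)).
Proof.
case: p => [[I k'] j]; rewrite iter_stepx; split=> /=; last first.
- by apply/eqmodnZ; rewrite qnE; apply: iterg_comm_mod.
- apply/eqmodnZ; have [z e] := sumg_comm_mod j; exists z.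
  by rewrite qnE PoszD e !SZ PoszD; ring.
apply/eqmodnZ; rewrite MnE.
have := sum_itergS al j => /=; set S := (\sum_(t < al) gsum _ _)%N => eS.
have {}eS : S%:Z = (sumg al j)%:Z + (iterg al j)%:Z - j%:Z.
  by apply: (addIr j%:Z); have := congr1 Posz eS; rewrite !PoszD => ->; ring.
have [z eZ] := relator_mod k' j; move: eZ; set T := (\sum_(t < al) _)%N => eZ.
rewrite !PoszD !PoszM !PoszX be1E -/H.
have eT : al%:Z ^+ k' * T%:Z = al%:Z ^+ k' * al%:Z + (be%:Z * (iterg al j)%:Z
    - (gsum be (be * j))%:Z + H * (be%:Z * j%:Z - (sumg al j)%:Z) + M * z).
  by rewrite -eZ PoszX; ring.
exists (- z + 2 * H * V * j%:Z + (gsum be (be * j))%:Z - S%:Z - 2 * H * V * (iterg al j)%:Z).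
by rewrite eT KE eS exprSr beE; ring.
Qed.

(** The second relation in the form [y [y, x] = [y, x] y ^ be]; it holds before any reduction. *)
Lemma stepy_stepd p : stepd (stepy p) = iter be stepy (stepd p).
Proof.
have iter_stepy n q : iter n stepy q = ((q.1.1 + n * K)%N, q.1.2, (q.2 + n)%N).
  elim: n => [|n IHn]; first by case: q => [[]] /= *; rewrite !addn0.
  by rewrite iterS IHn /stepy /= addnS mulSn addnA addnAC.
rewrite iter_stepy /stepd /=; congr (_, _, _); last by rewrite mulnS addnC.
by rewrite be_eq /=; ring.
Qed.

(** This is [x y [y, x] = y x], which identifies [stepd] with the action of the commutator. *)
Lemma stepd_comm p : eqp (stepd (stepy (stepx p))) (stepx (stepy p)).
Proof.
case: p => [[I k'] j]; split=> //=; last by rewrite addnS.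
apply/eqmodnZ; rewrite MnE gsumS; exists (-1).
by rewrite !PoszD !PoszM be1E !SZ KE beE; ring.
Qed.

Local Close Scope ring_scope.
Local Open Scope group_scope.

Let X : finType := ('I_Mn * 'I_qn * 'I_qn)%type.

Let Mn_gt0 : (0 < Mn)%N. Proof. by rewrite /Mn muln_gt0 expn_gt0 h_gt0. Qed.
Let qn_gt0 : (0 < qn)%N. Proof. by rewrite /qn muln_gt0 expn_gt0 h_gt0. Qed.

Let red (p : nat * nat * nat) : X := (Ordinal (ltn_pmod p.1.1 Mn_gt0),
  Ordinal (ltn_pmod p.1.2 qn_gt0), Ordinal (ltn_pmod p.2 qn_gt0)).
Let lift (x : X) : nat * nat * nat := (x.1.1 : nat, x.1.2 : nat, x.2 : nat).

Let redP p p' : reflect (eqp p p') (red p == red p').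
Proof.
apply: (iffP eqP) => [[eI ek ej]|[eI ek ej]]; first by split.
by congr (_, _, _); apply: val_inj.
Qed.

Let liftK : cancel lift red.
Proof.
by case=> [[i k'] j]; congr (_, _, _); apply: val_inj; rewrite /= modn_small.
Qed.

Let lift_red p : eqp (lift (red p)) p.
Proof. by split; rewrite /= modn_mod. Qed.

Let red_step f p : (forall p p', eqp p p' -> eqp (f p) (f p')) ->
  red (f (lift (red p))) = red (f p).
Proof. by move=> hf; apply/eqP/redP/hf/lift_red. Qed.

Let permx_inj : injective (fun x => red (stepx (lift x))).
Proof.
move=> x x' /eqP/redP/stepx_inj e; rewrite -[x]liftK -[x']liftK.
exact/eqP/redP.
Qed.

Let permy_inj : injective (fun x => red (stepy (lift x))).
Proof.
move=> x x' /eqP/redP[/= /eqP e1 e2 /eqP e3]; rewrite -[x]liftK -[x']liftK.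
apply/eqP/redP; split=> //=; apply/eqP; first by rewrite eqn_modDr in e1.
by rewrite -(addn1 x.2) -(addn1 x'.2) eqn_modDr in e3.
Qed.

Let px : {perm X} := perm permx_inj.
Let py : {perm X} := perm permy_inj.

Let pxE p : px (red p) = red (stepx p).
Proof. by rewrite permE red_step //; apply: stepx_eqp. Qed.
Let pyE p : py (red p) = red (stepy p).
Proof. by rewrite permE red_step //; apply: stepy_eqp. Qed.

Let pdE p : [~ py, px] (red p) = red (stepd p).
Proof.
have -> : [~ py, px] = (px * py)^-1 * (py * px) by rewrite commgEl conjgE invMg !mulgA.
have e r : (py * px) r = red (stepd (lift ((px * py) r))).
  rewrite -[r]liftK !permM pxE pyE pyE pxE red_step; last exact: stepd_eqp.
  by apply/esym/eqP/redP/stepd_comm.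
by rewrite permM e permKV red_step //; apply: stepd_eqp.
Qed.

Let pxXE n p : (px ^+ n) (red p) = red (iter n stepx p).
Proof. by elim: n => [|n IHn]; rewrite ?expg0 ?perm1 // expgSr permM IHn pxE. Qed.
Let pyXE n p : (py ^+ n) (red p) = red (iter n stepy p).
Proof. by elim: n => [|n IHn]; rewrite ?expg0 ?perm1 // expgSr permM IHn pyE. Qed.

Let rel_px : px ^ [~ px, py] = px ^+ al.
Proof.
rewrite -(invg_comm py px); set D := [~ py, px].
have DE : forall p, D (red p) = red (stepd p) := pdE; clearbody D.
rewrite conjgE invgK; apply: (mulIg D); rewrite -!mulgA mulVg mulg1.
apply/permP=> r; rewrite -[r]liftK !permM DE pxE pxXE DE.
exact/eqP/redP/stepx_stepd.
Qed.

Let rel_py : py ^ [~ py, px] = py ^+ be.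
Proof.
set D := [~ py, px].
have DE : forall p, D (red p) = red (stepd p) := pdE; clearbody D.
rewrite conjgE; apply: (mulgI D); rewrite mulKVg.
by apply/permP=> r; rewrite -[r]liftK !permM DE pyE pyXE DE stepy_stepd.
Qed.

Let orbit_model : orbit 'P <<[set px; py]>> (red (0, 0, 0)%N) = [set: X].
Proof.
have xG : px \in <<[set px; py]>> by rewrite mem_gen // !inE eqxx.
have yG : py \in <<[set px; py]>> by rewrite mem_gen // !inE eqxx orbT.
have dG : [~ py, px] \in <<[set px; py]>> by rewrite groupR.
apply/setP=> r; rewrite inE; apply/orbitP.
case: r => [[i k'] j].
(* Each factor [[y, x]] will add [h] to the first coordinate and each [y] will subtract 1, so the
   power of [x] must be [i - h k' + j] modulo [Mn]. *)
pose i0 := (i + (Mn - h * k' %% Mn) + j)%N.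
exists (px ^+ i0 * [~ py, px] ^+ k' * py ^+ j); first by rewrite !groupM ?groupX.
have ex n : iter n stepx (0, 0, 0)%N = (n, 0, 0)%N.
  by elim: n => // n IHn; rewrite iterS IHn /stepx /= expn0 !muln0 !addn0 addn1.
have pdXE n I : ([~ py, px] ^+ n) (red (I, 0, 0)%N) = red (I + n * h, n, 0)%N.
  elim: n => [|n IHn]; first by rewrite expg0 perm1 addn0.
  by rewrite expgSr permM IHn pdE /stepd /= !muln0 addn0 -addnA -mulSnr.
have ey n I : iter n stepy (I, k' : nat, 0)%N = (I + n * K, k' : nat, n)%N.
  elim: n => [|n IHn]; first by rewrite addn0.
  by rewrite iterS IHn /stepy /= -addnA -mulSnr.
change (aperm (red (0, 0, 0)%N) (px ^+ i0 * [~ py, px] ^+ k' * py ^+ j) = (i, k', j)).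
rewrite /aperm !permM pxXE ex pdXE pyXE ey -[RHS]liftK.
apply/eqP/redP; split=> //=.
have e1 : (h * k' = (h * k') %/ Mn * Mn + h * k' %% Mn)%N by apply: divn_eq.
have e2 : (h * k' %% Mn < Mn)%N by rewrite ltn_pmod.
rewrite -(modnMDl (1 + (h * k') %/ Mn + j)%N i) /K /i0 [(k' * h)%N]mulnC.
congr (_ %% _)%N; move: e1 e2; set A := (_ %/ _)%N; set B := (_ %% _)%N => -> e2.
have e3 : (j * Mn = j + j * Mn.-1)%N by rewrite -{1}(prednK Mn_gt0) mulnS.
by rewrite !mulnDl e3 mul1n; lia.
Qed.

Lemma model_exists : exists x y : {perm 'I_(4 * h ^ 3) * 'I_(2 * h ^ 2) * 'I_(2 * h ^ 2)},
  [/\ x ^ [~ x, y] = x ^+ al, y ^ [~ y, x] = y ^+ be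
    & (4 * h ^ 3 * (2 * h ^ 2) * (2 * h ^ 2) %| #|<<[set x; y]>>|)%N].
Proof.
exists px, py; split=> //.
have := dvdn_orbit 'P <<[set px; py]>>%G (red (0, 0, 0)%N).
by rewrite orbit_model cardsT !card_prod !card_ord.
Qed.

End Model.

(** * The structure of the Sylow 2-subgroup *)

Section TwoElements.

Variable gT : finGroupType.
Implicit Types x y : gT.

Lemma cycle_exp_odd x n w : 2.-elt x -> odd w -> <[x ^+ (n * w)]> = <[x ^+ n]>.
Proof.
move=> x2 w_odd; rewrite expgM; apply/eqP; rewrite eq_sym.
rewrite -[_ == _]/(generator _ _) generator_coprime.
by apply: (@pnat_coprime 2); [apply: p_eltX|rewrite -odd_2'nat].
Qed.

Lemma cycle_mul_sq x y : 2.-elt x -> y \in <[x ^+ 2]> -> <[x * y]> = <[x]>.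
Proof.
move=> x2 /cycleP[t ->]; rewrite -expgM -[x in x * _]expg1 -expgD.
by rewrite -(mul1n (1 + _)%N) cycle_exp_odd // oddD oddM.
Qed.

Lemma cycle_exp_eq x y n : <[x]> = <[y]> -> <[x ^+ n]> = <[y ^+ n]>.
Proof.
have sub z t : <[z]> = <[t]> -> <[z ^+ n]> \subset <[t ^+ n]>.
  move=> e; have /cycleP[i ->] : z \in <[t]> by rewrite -e cycle_id.
  by rewrite cycle_subG -expgM mulnC expgM mem_cycle.
by move=> e; apply/eqP; rewrite eqEsubset !sub.
Qed.

Lemma cycle_expM_sub x n w : <[x ^+ (n * w)]> \subset <[x ^+ n]>.
Proof. by rewrite cycle_subG expgM mem_cycle. Qed.

End TwoElements.

(** * Expansions in powers of two *)

Section TwoAdic.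

Variables (k u h al : nat).
Hypotheses (u_odd : odd u) (hE : h = (2 ^ k.+1)%N) (alE : al = (2 * h * u).+1).

Lemma expn_1D N z w : exists z', ((1 + N * z) ^ w = 1 + N * z')%N.
Proof.
elim: w => [|w [z' IHw]]; first by exists 0%N; rewrite expn0 muln0.
by exists (z + z' + N * z * z')%N; rewrite expnS IHw; ring.
Qed.

Lemma sum_expn_1D N z w : exists z', (\sum_(t < w) (1 + N * z) ^ t = w + N * z')%N.
Proof.
elim: w => [|w [z' IHw]]; first by exists 0%N; rewrite big_ord0 muln0.
have [t et] := expn_1D N z w.
by exists (z' + t)%N; rewrite big_ord_recr /= IHw et; ring.
Qed.

Lemma exp_pow2 i w : exists z, (al ^ (2 ^ i * w) = 1 + 2 * h * 2 ^ i * z)%N.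
Proof.
suff [z e] : exists z, (al ^ (2 ^ i) = 1 + 2 * h * 2 ^ i * z)%N.
  by rewrite expnM e; apply: expn_1D.
elim: i => [|i [z IHi]]; first by exists u; rewrite alE expn1 muln1 add1n.
exists (z + h * 2 ^ i * z ^ 2)%N; rewrite expnS mulnC expnM IHi; ring.
Qed.

(** For even [n] this reads [gsum al n = n (1 + h)] modulo [2 h n]. It is established for [n = 2],
    then by doubling, then for multiples [w]. *)
Lemma gsum_pow2 i w :
  exists z, (gsum al (2 ^ i.+1 * w) = 2 ^ i.+1 * (w * (1 + h) + 2 * h * z))%N.
Proof.
suff [z e] : exists z, (gsum al (2 ^ i.+1) = 2 ^ i.+1 * (1 + h + 2 * h * z))%N.
  have [t et] := exp_pow2 i.+1 1; rewrite muln1 in et.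
  rewrite gsumM e et -[(2 * h * 2 ^ i.+1 * t)%N]mulnA.
  have [s ->] := sum_expn_1D (2 * h) (2 ^ i.+1 * t) w.
  by exists (z * w + s * (1 + h + 2 * h * z))%N; ring.
elim: i => [|i [z IHi]].
  have -> : gsum al (2 ^ 1) = (al * al.+1)%N by rewrite /gsum /=; ring.
  (* Here [al (al + 1) = 2 (1 + 3 h u + 2 h^2 u^2)], and [3 u] is odd; its odd unit produces the
     summand [h]. *)
  exists ((3 * u)./2 + h * u ^ 2)%N; rewrite alE.
  have := odd_double_half (3 * u); rewrite oddM u_odd /=.
  by rewrite -mul2n; nia.
rewrite (expnSr 2 i.+1) gsumM IHi.
have [t et] := exp_pow2 i.+1 1; rewrite muln1 in et.
rewrite big_ord_recr big_ord1 /= et !(expnS 2 i).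
exists (z + t * 2 ^ i * (1 + h + 2 * h * z))%N.
ring.
Qed.

Lemma gsum_lt a n : (1 < a -> (gsum a n).+1 <= a ^ n.+1)%N.
Proof.
move=> a_gt1; elim: n => [|n IHn]; first by rewrite expn1 ltnW.
rewrite gsumSr (expnS _ n.+1); move: IHn; set g := gsum a n; set e := (a ^ n.+1)%N; nia.
Qed.

(** Both numbers have the form [1 + 2 h u + 2 h^2 t]: for [al ^ al] the coefficient [t] is even,
    while for the power sum it is [u + 2 z], which is odd. *)
Lemma exp_gsum_diff :
  exists2 w, odd w & (al ^ al = (gsum al al.-1).+1 + 2 * h ^ 2 * w)%N.
Proof.
have h_gt0 : (0 < h)%N by rewrite hE expn_gt0.
have u_gt0 : (0 < u)%N by case: (u) u_odd.
have hu : (2 * h * u = 2 ^ k.+2 * u)%N by rewrite hE -expnS.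
have al_gt1 : (1 < al)%N by rewrite alE ltnS !muln_gt0 h_gt0 u_gt0.
have e1 : ((gsum al al.-1).+1 <= al ^ al)%N.
  by have := gsum_lt al.-1 al_gt1; rewrite prednK // ltnW.
have [z ez] := gsum_pow2 k.+1 u; rewrite -hu in ez.
have [s es] := exp_pow2 k.+2 u; rewrite -hu in es.
have alP : al.-1 = (2 * h * u)%N by rewrite alE.
have ea : (al ^ al = al * (1 + 4 * h ^ 2 * s))%N.
  rewrite {2}alE expnS es; congr (_ * _)%N; rewrite (expnS 2 k.+1) -hE; ring.
have eg : (gsum al al.-1).+1 = (1 + 2 * h * u + 2 * h ^ 2 * (u + 2 * z))%N.
  by rewrite alP ez (expnS 2 k.+1) -hE; ring.
have ea' : (al ^ al = 1 + 2 * h * u + 2 * h ^ 2 * (2 * s * al))%N.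
  by rewrite ea alE; ring.
have le : (u + 2 * z <= 2 * s * al)%N.
  by move: e1; rewrite ea' eg leq_add2l leq_pmul2l // muln_gt0 expn_gt0 h_gt0.
exists (2 * s * al - (u + 2 * z))%N.
  by rewrite oddB // oddD -!mulnA !oddM u_odd.
by rewrite ea' eg -[RHS]addnA -mulnDr subnKC.
Qed.

End TwoAdic.

Lemma quotient_gen2 (gT : finGroupType) (A B : gT) (Z : {group gT}) :
  <<[set A; B]>> \subset 'N(Z) ->
  <<[set A; B]>> / Z = <<[set coset Z A; coset Z B]>>.
Proof.
rewrite gen_subG => nZ; rewrite quotient_gen //.
by move: nZ; rewrite subUset !sub1set => /andP[nA nB]; rewrite quotientU !quotient_set1.
Qed.

(** * Upper bound for a 2-group satisfying the relations *)

Section UpperBound.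

Variables (gT : finGroupType) (a b : gT) (k u v d h al be : nat).
Hypotheses (u_odd : odd u) (v_odd : odd v) (hE : h = (2 ^ k.+1)%N).
Hypotheses (alE : al = (2 * h * u).+1) (beE : be = (2 * h * v).+1).
Hypothesis al_be : al = (be + 4 * h ^ 2 * d)%N.
Hypotheses (relA : a ^ [~ a, b] = a ^+ al) (relB : b ^ [~ b, a] = b ^+ be).
Local Notation G := <<[set a; b]>>.
Local Notation c := [~ a, b].
Local Notation q := (2 * h ^ 2)%N.
Hypothesis G2 : 2.-group G.

Let aG : a \in G. Proof. by rewrite mem_gen // !inE eqxx. Qed.
Let bG : b \in G. Proof. by rewrite mem_gen // !inE eqxx orbT. Qed.
Let cG : c \in G. Proof. by rewrite groupR. Qed.
Let a2 : 2.-elt a. Proof. exact: mem_p_elt G2 aG. Qed.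
Let b2 : 2.-elt b. Proof. exact: mem_p_elt G2 bG. Qed.
Let c2 : 2.-elt c. Proof. exact: mem_p_elt G2 cG. Qed.

Lemma relB_swap n j : c ^+ n * b ^+ j = b ^+ (j * be ^ n) * c ^+ n.
Proof.
have := relA_swap relB j n; rewrite -(invg_comm a b) expgVn => e.
by apply: (mulgI (c ^- n)); rewrite !mulgA mulVg mul1g -e -mulgA mulVg mulg1.
Qed.

Lemma conj_expB n : (b ^+ n) ^ a = c ^- n * b ^+ gsum be n.
Proof. by rewrite (conj_expA relB) -(invg_comm a b) expgVn. Qed.

(* Both sides are the commutator of [a] and [b ^+ be = b ^ c^-1]. *)
Lemma master_relation : a^-1 * c ^+ al * a ^+ (gsum al al.-1).+1
  = b ^- gsum be be * c ^+ be * b ^+ be.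
Proof.
have al_gt0 : (0 < al)%N by rewrite alE.
have eg : gsum al al = (al * (gsum al al.-1).+1)%N.
  by rewrite -{2}(prednK al_gt0) gsumS.
have e1 : a ^ (b ^+ be) = c ^+ al * a ^+ (gsum al al.-1).+1.
  have eb : b ^+ be * c = c * b.
    by rewrite -relB -(invg_comm a b) conjgE invgK -!(mulgA c) -(mulgA b) mulVg mulg1.
  apply: (conjg_inj c); rewrite -conjgM eb conjgM relA (conj_expA relA) eg conjMg.
  by rewrite (conjXg _ c) (conjXg _ c) [c ^ c]conjgE mulKg relA -expgM.
have -> : a^-1 * c ^+ al * a ^+ (gsum al al.-1).+1 = [~ a, b ^+ be].
  by rewrite [RHS]commgEl e1 mulgA.
by rewrite [LHS]commgEr conjVg conj_expB invMg invgK.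
Qed.

Let cNa n : c ^+ n \in 'N(<[a]>).
Proof. by rewrite groupX // -cycle_subG norms_cycle relA mem_cycle. Qed.

Let cNb n : c ^+ n \in 'N(<[b]>).
Proof.
by rewrite groupX // -groupV -cycle_subG norms_cycle invg_comm relB mem_cycle.
Qed.

(** In [master_relation], moving [a^-1] across [c ^ al] and [b ^ be] across [c ^ be] leaves
    [c ^ al a ^ (- q x) = b ^ (q be y) c ^ be], with [x] and [y] odd by [exp_gsum_diff]. Then [s] is
    the conjugate of that power of [b] by [c ^ be]. *)
Lemma power_relation : exists2 s, <[s]> = <[b ^+ q]> &
  exists2 x, odd x & c ^+ (4 * h ^ 2 * d) = s * a ^+ (q * x).
Proof.
have [x x_odd ex] := exp_gsum_diff u_odd hE alE.
have [y y_odd ey] := exp_gsum_diff v_odd hE beE.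
have be_gt0 : (0 < be)%N by rewrite beE.
pose s := (b ^+ (q * (be * y))) ^ (c ^+ be).
exists s.
  have be_odd : odd be by rewrite beE /= -mulnA oddM.
  rewrite /s conjXg -[in RHS](cycle_exp_odd q (w := be * y)) // ?oddM ?be_odd //.
  apply: (@cycle_exp_eq _ (b ^ (c ^+ be)) b).
  by rewrite cycleJ (normP (cNb be)).
exists x => //.
apply: (mulIg (a ^- (q * x))); rewrite mulgK.
have e1 : a^-1 * c ^+ al = c ^+ al * a ^- (al ^ al).
  apply: (mulgI a); rewrite mulKVg -{2}[a]expg1 mulgA (relA_swap relA) mul1n.
  by rewrite mulgK.
have e2 : a ^- (al ^ al) * a ^+ (gsum al al.-1).+1 = a ^- (q * x).
  by rewrite ex expgD invMg mulgKV.
have e3 : b ^- gsum be be * (c ^+ be * b ^+ be) = b ^+ (q * (be * y)) * c ^+ be.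
  rewrite relB_swap mulgA; congr (_ * _); apply: (mulgI (b ^+ gsum be be)).
  rewrite mulKVg -expgD; congr (b ^+ _).
  have -> : gsum be be = (be * (gsum be be.-1).+1)%N.
    by rewrite -{2}(prednK be_gt0) gsumS.
  by rewrite ey; ring.
rewrite /s conjgE -e3 [_ * (c ^+ be * _)]mulgA -master_relation e1 -[c ^+ al * _ * _]mulgA e2.
by rewrite {1}al_be expgD -!mulgA mulKg.
Qed.

Let qE : q = (2 ^ (k + k.+2).+1)%N.
Proof. by rewrite hE -expnM -expnS; congr (2 ^ _)%N; lia. Qed.

Let cycle_conj_c n i : <[(a ^+ n) ^ (c ^- i)]> = <[a ^+ n]>.
Proof.
rewrite conjXg; apply: (@cycle_exp_eq _ (a ^ (c ^- i)) a).
by rewrite cycleJ (normP _) // groupV.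
Qed.

(** Conjugating [power_relation] by [c^-1] fixes its left side, raises [s] to the power [be] and
    replaces [a ^ (q x)] by its [al]-th root [y]. Hence [s y ^ al = s ^ be y], that is
    [y ^ (al - 1) = s ^ (be - 1)]. *)
Let pow2_cycle : <[b ^+ (q * (2 * h))]> = <[a ^+ (q * (2 * h))]>.
Proof.
have [s es [x x_odd eR]] := power_relation.
pose y := (a ^+ (q * x)) ^ (c ^- 1).
have cyN : <[y]> = <[a ^+ q]> by rewrite /y cycle_conj_c cycle_exp_odd.
have y2 : 2.-elt y by rewrite p_eltJ p_eltX.
have [i ei] : exists i, s = b ^+ i.
  by apply/cycleP; apply: subsetP (cycle_id s); rewrite es cycle_subG mem_cycle.
have s2 : 2.-elt s by rewrite ei p_eltX.
have sb : s ^ (c ^- 1) = s ^+ be.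
  by rewrite expg1 ei conjXg invg_comm relB -!expgM mulnC.
have yal : y ^+ al = a ^+ (q * x).
  rewrite /y -conjXg -expgM mulnC expgM -relA -conjXg expg1.
  by rewrite conjgK.
have e : y ^+ (2 * h * u) = s ^+ (2 * h * v).
  have : s * y ^+ al = s ^+ be * y.
    rewrite yal -eR -sb /y -conjMg -eR.
    by rewrite expg1 conjXg conjgE invgK mulgV mulg1.
  have cancel (r t : gT) m n : r * t ^+ m.+1 = r ^+ n.+1 * t -> t ^+ m = r ^+ n.
    by rewrite expgSr expgS mulgA => /mulIg/mulgI.
  by rewrite alE beE => /cancel.
rewrite !(expgM _ q) -(cycle_exp_eq (2 * h) cyN) -(cycle_exp_eq (2 * h) es).
by rewrite -(cycle_exp_odd _ y2 u_odd) -(cycle_exp_odd _ s2 v_odd) e.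
Qed.

(** Conjugating [power_relation] by [b] multiplies the left side by [t], a power of [b ^ (2 h q)],
    and turns [a ^ (q x)] into [c ^ (q x) a ^ gsum al (q x)]. So [c ^ (q x)] is an odd power of
    [a ^ (q h)] times [t], and [t] lies in the squares of [<[a ^ (q h)]>] by [pow2_cycle]. *)
Let cq_cycle : <[c ^+ q]> = <[a ^+ (q * h)]>.
Proof.
have [s es [x x_odd eR]] := power_relation.
have [i ei] : exists i, s = b ^+ i.
  by apply/cycleP; apply: subsetP (cycle_id s); rewrite es cycle_subG mem_cycle.
have eD : (4 * h ^ 2 * d = 2 ^ (k + k.+2).+2 * d)%N by rewrite (expnS 2 (k + k.+2).+1) -qE; ring.
have [z ez] := exp_pow2 beE (k + k.+2).+2 d.
have [z' ez'] := gsum_pow2 u_odd hE alE (k + k.+2) x.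
rewrite -eD in ez; rewrite -qE in ez'.
pose t := b ^+ (be ^ (4 * h ^ 2 * d)).-1.
have tE : t \in <[a ^+ (q * (2 * h))]>.
  rewrite -pow2_cycle /t ez (expnS 2 (k + k.+2).+1) -qE.
  rewrite add1n /= (_ : 2 * h * (2 * q) * z = q * (2 * h) * (2 * z))%N; last by ring.
  by rewrite (expgM _ (q * (2 * h))) mem_cycle.
have e : c ^+ (q * x) = a ^- (q * h * (x + 2 * z')) * t.
  have e1 : (c ^+ (4 * h ^ 2 * d)) ^ b = t * c ^+ (4 * h ^ 2 * d).
    have := relB_swap (4 * h ^ 2 * d) 1; rewrite expg1 mul1n conjgE => ->.
    rewrite /t.
    have : (0 < be ^ (4 * h ^ 2 * d))%N by rewrite expn_gt0 beE.
    by move/prednK => {1}<-; rewrite expgS !mulgA mulVg mul1g.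
  have sB : s ^ b = s by rewrite ei conjXg conjgE mulKg.
  have ts : t * s = s * t by rewrite ei /t -!expgD addnC.
  have [m em] : exists m, t = a ^+ m.
    by apply/cycleP; apply: subsetP tE; rewrite cycle_subG mem_cycle.
  move: e1; rewrite eR conjMg (conj_expA relA) sB [t * _]mulgA ts -[s * t * _]mulgA => /mulgI.
  rewrite ez' em -expgD => e1; apply: (mulIg (a ^+ (q * (x * (1 + h) + 2 * h * z')))).
  rewrite e1 -mulgA -expgD; apply: (mulgI (a ^+ (q * h * (x + 2 * z')))).
  by rewrite mulKVg -expgD; congr (a ^+ _); ring.
rewrite -(cycle_exp_odd q c2 x_odd) e.
have w_odd : odd (x + 2 * z') by rewrite oddD oddM /= addbF.
rewrite cycle_mul_sq ?p_eltV ?p_eltX //; first by rewrite cycleV cycle_exp_odd.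
rewrite expgVn cycleV -expgM mulnAC cycle_exp_odd //.
by rewrite (_ : q * h * 2 = q * (2 * h))%N //; ring.
Qed.

(** The left side of [power_relation] is a power of [c ^ (2 q)], hence by [cq_cycle] lies in
    [<[a ^ (2 h q)]>]; so [s] is an odd power of [a ^ q]. *)
Let bq_cycle : <[b ^+ q]> = <[a ^+ q]>.
Proof.
have [s es [x x_odd eR]] := power_relation.
have cD : c ^+ (4 * h ^ 2 * d) \in <[a ^+ (q * (2 * h))]>.
  rewrite (_ : 4 * h ^ 2 * d = q * (2 * d))%N; last by ring.
  have /cycleP[i ei] : c ^+ q \in <[a ^+ (q * h)]> by rewrite -cq_cycle cycle_id.
  rewrite expgM ei -!expgM (_ : _ * _ = q * (2 * h) * (i * d))%N; last by ring.
  by rewrite expgM mem_cycle.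
rewrite -es.
have -> : s = a ^- (q * x) * c ^+ (4 * h ^ 2 * d).
  have [m em] : exists m, c ^+ (4 * h ^ 2 * d) = a ^+ m.
    by apply/cycleP; apply: subsetP cD; rewrite cycle_subG mem_cycle.
  move: eR; rewrite em => eR; apply: (mulIg (a ^+ (q * x))); rewrite -eR.
  by apply: (mulgI (a ^+ (q * x))); rewrite -mulgA mulKVg -!expgD addnC.
rewrite cycle_mul_sq ?p_eltV ?p_eltX //; first by rewrite cycleV cycle_exp_odd.
rewrite expgVn cycleV -expgM [(q * x * 2)%N]mulnAC cycle_exp_odd //.
have sub : <[a ^+ (q * (2 * h))]> \subset <[a ^+ (q * 2)]>.
  by rewrite mulnA cycle_expM_sub.
exact: subsetP sub _ cD.
Qed.

Lemma aq_center : a ^+ q \in 'Z(G).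
Proof.
apply: mem_center_gen2; first by rewrite groupX.
  by rewrite conjXg conjgE mulKg.
have /cycleP[i ->] : a ^+ q \in <[b ^+ q]> by rewrite bq_cycle cycle_id.
by rewrite !conjXg conjgE mulKg.
Qed.

Lemma a_exp : a ^+ (4 * h ^ 3) = 1.
Proof.
have e : (4 * h ^ 3 = q * (2 * h))%N by ring.
apply/eqP; rewrite e -cycle_eq1 -(cycle_exp_odd _ a2 u_odd) cycle_eq1.
have /centP/(_ c cG) cc : a ^+ q \in 'C(G) by case/setIP: aq_center.
have : (a ^+ q) ^ c = a ^+ q by apply/conjg_fixP/commgP.
rewrite conjXg relA -!expgM => /eqP; rewrite -(inj_eq (mulgI (a ^- q))) mulVg.
rewrite (_ : al * q = q + q * (2 * h) * u)%N; last by rewrite alE; ring.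
by rewrite (expgD _ q) mulKg.
Qed.

Let aq_Z n : a ^+ (q * n) \in 'Z(G).
Proof. by rewrite expgM groupX ?aq_center. Qed.

Let bq_Z n : b ^+ (q * n) \in 'Z(G).
Proof.
rewrite expgM groupX //; have /cycleP[i ->] : b ^+ q \in <[a ^+ q]>.
  by rewrite -bq_cycle cycle_id.
by rewrite groupX ?aq_center.
Qed.

(** The set [<[a]> <[c]> <[b]>] contains 1 and is stable under right multiplication by [a] and [b],
    so it contains [G]. As [c ^ q] and [b ^ q] lie in [<[a]>] and [b ^ q] is central, the exponents
    of [c] and [b] may be reduced modulo [q]. *)
Lemma card_upper : (#|G| <= #[a] * q * q)%N.
Proof.
have q_gt0 : (0 < q)%N by rewrite muln_gt0 expn_gt0 hE expn_gt0.
pose S := <[a]> * <[c]> * <[b]>.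
have memS x i j : x \in <[a]> -> x * c ^+ i * b ^+ j \in S.
  by move=> xa; rewrite !mem_mulg ?mem_cycle.
have SP t : t \in S -> exists2 x, x \in <[a]> & exists i, exists j, t = x * c ^+ i * b ^+ j.
  case/mulsgP=> _ _ /mulsgP[x _ xa /cycleP[i ->] ->] /cycleP[j ->] ->.
  by exists x => //; exists i, j.
have eqS g : S :* g \subset S -> S :* g = S.
  by move=> sub; apply/eqP; rewrite eqEcard sub card_rcoset leqnn.
have SB : S :* b = S.
  apply/eqS/subsetP=> _ /rcosetP[t /SP[x xa [i [j ->]]] ->].
  by rewrite -mulgA -expgSr memS.
have SA : S :* a = S.
  apply/eqS/subsetP=> _ /rcosetP[t /SP[x xa [i [j ->]]] ->].
  have -> : x * c ^+ i * b ^+ j * a = x * (a ^ (c ^- i)) * (c ^+ i * c ^- j) * b ^+ gsum be j.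
    have aux (y z C D E : gT) : y * (C * (z * C^-1)) * (C * D) * E = y * C * (z * (D * E)).
      by rewrite !mulgA mulgKV.
    by rewrite -mulgA (conjgC (b ^+ j)) conj_expB conjgE invgK aux.
  have /cycleP[n ->] : c ^+ i * c ^- j \in <[c]> by rewrite groupM ?groupV ?mem_cycle.
  rewrite memS // groupM // memJ_norm ?cycle_id // groupV; exact: cNa.
have GS : G \subset S.
  have sG : G \subset 'C[S | 'Rs].
    by rewrite gen_subG subUset !sub1set; apply/andP; split; apply/astab1P; rewrite /= rcosetE.
  apply/subsetP=> g /(subsetP sG)/astab1P; rewrite /= rcosetE => e.
  suff: g \in S :* g by rewrite e.
  apply/rcosetP.
  exists 1; rewrite ?mul1g //; have := memS 1 0%N 0%N (group1 _).
  by rewrite !expg0 !mulg1.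
pose f (t : gT * ('I_q * 'I_q)) := t.1 * c ^+ t.2.1 * b ^+ t.2.2.
have SF : S \subset f @: setX <[a]> setT.
  apply/subsetP=> t /SP[x xa [i [j ->]]].
  rewrite (divn_eq i q) (divn_eq j q) [(i %/ q * q)%N]mulnC [(j %/ q * q)%N]mulnC !expgD.
  have ca : c ^+ (q * (i %/ q)) \in <[a]>.
    have sca : <[c ^+ q]> \subset <[a]> by rewrite cq_cycle cycle_subG mem_cycle.
    by rewrite expgM groupX // (subsetP sca) ?cycle_id.
  have ba : b ^+ (q * (j %/ q)) \in <[a]>.
    have sba : <[b ^+ q]> \subset <[a]> by rewrite bq_cycle cycle_subG mem_cycle.
    by rewrite expgM groupX // (subsetP sba) ?cycle_id.
  apply/imsetP; exists (x * c ^+ (q * (i %/ q)) * b ^+ (q * (j %/ q)),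
    (Ordinal (ltn_pmod i q_gt0), Ordinal (ltn_pmod j q_gt0))).
    by rewrite !inE andbT !groupM.
  rewrite /f /= -!mulgA; congr (_ * (_ * _)); rewrite !mulgA; congr (_ * _).
  by have /setIP[_ /centP cb] := bq_Z (j %/ q); apply/esym/cb; rewrite groupX.
apply: leq_trans (subset_leq_card (subset_trans GS SF)) _.
apply: leq_trans (leq_imset_card _ _) _.
by rewrite cardsX cardsT card_prod !card_ord mulnA.
Qed.

(** * Orders of the generators and nilpotency class *)

Let order_exp_pow2 (y : gT) j : 2.-elt y -> y ^+ (2 ^ j) != 1 ->
  #[y] = (2 ^ j * #[y ^+ (2 ^ j)])%N.
Proof.
move=> y2 yj; have [i ei] := p_natP y2.
have ji : (2 ^ j %| #[y])%N.
  rewrite ei dvdn_exp2l // leqNgt; apply: contra yj => ij.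
  by rewrite -order_dvdn ei dvdn_exp2l // ltnW.
by rewrite orderXdiv // mulnC divnK.
Qed.

(** The assumed lower bound leaves no slack in [card_upper] and [a_exp], which fixes [#[a]];
    [bq_cycle] and [cq_cycle] transfer it to [b] and [c]. *)
Lemma orders_upper : (4 * h ^ 3 * q * q <= #|G|)%N ->
  [/\ #|G| = (4 * h ^ 3 * q * q)%N, #[a] = (4 * h ^ 3)%N, #[b] = (4 * h ^ 3)%N
    & #[c] = (2 * q)%N].
Proof.
move=> leG; have h_gt0 : (0 < h)%N by rewrite hE expn_gt0.
have q_gt0 : (0 < q)%N by rewrite muln_gt0 expn_gt0 h_gt0.
have e4 : (4 * h ^ 3 = q * (2 * h))%N by ring.
have oa : #[a] = (4 * h ^ 3)%N.
  apply/eqP; rewrite eqn_leq dvdn_leq ?order_dvdn ?a_exp // ?muln_gt0 ?expn_gt0 ?h_gt0 //=.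
  by have := leq_trans leG card_upper; rewrite !leq_pmul2r.
have a_neq1 n : (0 < n < 4 * h ^ 3)%N -> a ^+ n != 1.
  by case/andP=> n_gt0 ltn; rewrite -order_dvdn oa gtnNdvd.
have h2 : (1 < 2 * h)%N by lia.
have aq : a ^+ q != 1 by rewrite a_neq1 // q_gt0 e4 ltn_Pmulr.
have aqh : #[a ^+ (q * h)] = 2%N.
  rewrite orderXdiv oa e4; last by rewrite dvdn_pmul2l // dvdn_mull.
  by rewrite divnMl // mulnK.
have bq : b ^+ q != 1 by rewrite -cycle_eq1 bq_cycle cycle_eq1.
have cq : c ^+ q != 1 by rewrite -cycle_eq1 cq_cycle cycle_eq1 -order_eq1 aqh.
split=> //.
- by apply/eqP; rewrite eqn_leq leG andbT -oa; apply: card_upper.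
- rewrite -oa; move: aq bq; rewrite qE => aq bq.
  by rewrite (order_exp_pow2 b2 bq) (order_exp_pow2 a2 aq) -qE /order bq_cycle.
move: cq; rewrite {1}qE => cq.
by rewrite (order_exp_pow2 c2 cq) -qE /order cq_cycle -/(order _) aqh mulnC.
Qed.

Let mem_ucn n x : x \in G -> [~ x, a] \in 'Z_n(G) -> [~ x, b] \in 'Z_n(G) ->
  x \in 'Z_n.+1(G).
Proof.
move=> xG xa xb; have nZ := ucn_norm n G.
have nZa := subsetP nZ _ aG; have nZb := subsetP nZ _ bG; have nZx := subsetP nZ _ xG.
rewrite ucnSn mem_morphpre // quotient_gen2 //.
have cx y : y \in 'N('Z_n(G)) -> [~ x, y] \in 'Z_n(G) ->
    coset 'Z_n(G) x ^ coset 'Z_n(G) y = coset 'Z_n(G) x.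
  move=> nZy xy; apply/conjg_fixP; rewrite -morphR //=.
  by apply/eqP; rewrite coset_id.
apply: mem_center_gen2; rewrite ?cx //.
by rewrite -quotient_gen2 // mem_quotient.
Qed.

Let comm_ca n : [~ c ^+ n, a] = a ^- (al ^ n).-1.
Proof.
rewrite commgEr conjVg -{1}[a]expg1 (conj_relA relA) mul1n.
have : (0 < al ^ n)%N by rewrite expn_gt0 alE.
by move/prednK => {1}<-; rewrite expgS invMg mulgKV.
Qed.

Let comm_cb n : [~ c ^+ n, b] = (b ^+ (be ^ n).-1) ^ (c ^+ n).
Proof.
rewrite commgEl !conjgE; congr (_ * _).
have := relB_swap n 1; rewrite expg1 mul1n => ->.
have : (0 < be ^ n)%N by rewrite expn_gt0 beE.
by move/prednK => {1}<-; rewrite expgS -!mulgA mulKg.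
Qed.

Let cXG n : c ^+ n \in G. Proof. exact: groupX. Qed.

Let h2E : (2 * h = 2 ^ k.+2 * 1)%N. Proof. by rewrite hE muln1 -expnS. Qed.

(** Climbing the upper central series: [a ^ q] and [b ^ q] lie in its first term, [c ^ (2 h)] in the
    second, [a ^ (2 h)] and [b ^ (2 h)] in the third, [c] in the fourth, [a] and [b] in the
    fifth. *)
Lemma nil_class_upper : (nil_class G <= 5)%N.
Proof.
have nZ n x y : x \in 'Z_n(G) -> y \in G -> x ^ y \in 'Z_n(G).
  by move=> xZ yG; rewrite memJ_norm // (subsetP (ucn_norm n G)).
have Z12 := subsetP (ucn_subS 1 G).
have aux (x y z : gT) : x^-1 * (y * (x * z)) = y ^ x * z by rewrite conjgE !mulgA.
have cZ2 : c ^+ (2 * h) \in 'Z_2(G).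
  have [z ez] := exp_pow2 alE k.+2 1; have [z' ez'] := exp_pow2 beE k.+2 1.
  apply: mem_ucn; rewrite ?cXG // ?comm_ca ?comm_cb ucn1 {1}h2E ?ez ?ez'.
    rewrite groupV add1n /= (_ : _ * _ = q * (2 * z))%N ?aq_Z //.
    by rewrite (expnS 2 k.+1) -hE; ring.
  rewrite -ucn1 nZ // ucn1 add1n /= (_ : _ * _ = q * (2 * z'))%N ?bq_Z //.
  by rewrite (expnS 2 k.+1) -hE; ring.
have aZ3 : a ^+ (2 * h) \in 'Z_3(G).
  have [z ez] := gsum_pow2 u_odd hE alE k.+1 1; rewrite -h2E in ez.
  apply: mem_ucn; rewrite ?groupX //.
    have -> : [~ a ^+ (2 * h), a] = 1 by apply/eqP/commgP/commute_sym/commuteX.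
    exact: group1.
  rewrite commgEl (conj_expA relA) ez (expnS 2 k.+1) -hE.
  rewrite (_ : 2 * h * (_ + _) = 2 * h + q * (1 + 2 * z))%N; last by ring.
  rewrite (expgD _ (2 * h)) aux; apply: groupM; first by rewrite nZ // groupX.
  by rewrite Z12 // ucn1 aq_Z.
have bZ3 : b ^+ (2 * h) \in 'Z_3(G).
  have [z ez] := gsum_pow2 v_odd hE beE k.+1 1; rewrite -h2E in ez.
  apply: mem_ucn; rewrite ?groupX //; last first.
    have -> : [~ b ^+ (2 * h), b] = 1 by apply/eqP/commgP/commute_sym/commuteX.
    exact: group1.
  rewrite commgEl conj_expB ez (expnS 2 k.+1) -hE.
  rewrite (_ : 2 * h * (_ + _) = 2 * h + q * (1 + 2 * z))%N; last by ring.
  rewrite (expgD _ (2 * h)) aux; apply: groupM; first by rewrite nZ ?groupV // groupX.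
  by rewrite Z12 // ucn1 bq_Z.
have cZ4 : c \in 'Z_4(G).
  apply: mem_ucn => //; rewrite -[c]expg1 ?comm_ca ?comm_cb expn1.
    by rewrite groupV alE /= expgM groupX.
  by rewrite nZ // beE /= expgM groupX.
have aZ5 : a \in 'Z_5(G).
  by apply: mem_ucn; [exact: aG | rewrite commgg; exact: group1 | exact: cZ4].
have bZ5 : b \in 'Z_5(G).
  apply: mem_ucn; first exact: bG.
    by rewrite -(invg_comm a b) groupV; exact: cZ4.
  by rewrite commgg; exact: group1.
have Z5 : 'Z_5(G) = G.
  by apply/eqP; rewrite eqEsubset ucn_sub gen_subG subUset !sub1set aZ5.
by apply/ucn_nil_classP; first exact: pgroup_nil G2.
Qed.

(** With [n = 2 h u], the element [[a ^ n, b, a]] of ['L_5(G)] is [a ^ (1 - al ^ n)]. If it were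
    trivial, [4 h^3] would divide [al (al ^ n - 1) = (al - 1) gsum al n], which is [4 h^2] times an
    odd number. *)
Lemma nil_class_lower : #[a] = (4 * h ^ 3)%N -> (5 <= nil_class G)%N.
Proof.
move=> oa; rewrite ltnNge; apply/negP => /(lcn_nil_classP _ (pgroup_nil G2)) L5.
have cL2 : c \in 'L_2(G) by rewrite lcnSn mem_commg.
have aL3 : a ^+ (2 * h * u) \in 'L_3(G).
  rewrite -groupV; have := mem_commg cL2 aG; rewrite -lcnSn.
  by have := comm_ca 1; rewrite expg1 expn1 alE /= => ->.
have := mem_commg (mem_commg aL3 bG) aG; rewrite -!lcnSn L5.
set n := (2 * h * u)%N; set y := [~ _, b].
have yE : y = a ^- n * (c ^+ n * a ^+ gsum al n) by rewrite /y commgEl (conj_expA relA).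
have -> : [~ y, a] = a ^- (al ^ n).-1.
  have ca : (c ^+ n) ^ a = c ^+ n * a ^- (al ^ n).-1 by rewrite -comm_ca commgEl mulKVg.
  have aX i : (a ^+ i) ^ a = a ^+ i by rewrite conjXg conjgE mulKg.
  have aC : a ^- (al ^ n).-1 * a ^+ gsum al n = a ^+ gsum al n * a ^- (al ^ n).-1.
    by apply/commute_sym/commuteV/commuteX2.
  rewrite commgEl {2}yE !conjMg conjVg !aX ca.
  by rewrite -[c ^+ n * _ * _]mulgA aC [c ^+ n * _]mulgA [a ^- n * _]mulgA -yE mulKg.
move=> /set1P/eqP; rewrite invg_eq1 -order_dvdn oa => dv.
have [z ez] := gsum_pow2 u_odd hE alE k.+1 u.
have hu : (2 * h * u = 2 ^ k.+2 * u)%N by rewrite hE -expnS.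
rewrite -hu -/n (expnS 2 k.+1) -hE in ez.
have : (4 * h ^ 3 %| al.-1 * gsum al n)%N by rewrite gsum_pred dvdn_mull.
rewrite ez alE /= (_ : 2 * h * u * (2 * h * _)
  = 4 * h ^ 2 * (u * (u * (1 + h) + 2 * h * z)))%N; last by ring.
rewrite (_ : 4 * h ^ 3 = 4 * h ^ 2 * h)%N ?dvdn_pmul2l; last by ring.
  rewrite hE expnS => /(dvdn_trans (dvdn_mulr _ (dvdnn 2))).
  by rewrite dvdn2 !(oddM, oddD) u_odd.
by rewrite muln_gt0 expn_gt0 hE expn_gt0.
Qed.

End UpperBound.

(** * Reduction to natural exponents and to the Sylow 2-subgroup *)

Lemma consttM_nil (gT : finGroupType) (G : {group gT}) (pi : nat_pred) :
  nilpotent G -> {in G &, {morph (fun x => x.`_pi) : x y / x * y}}.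
Proof.
move=> nilG x y xG yG.
have inO (rho : nat_pred) z : z \in G -> z.`_rho \in 'O_rho(G).
  move=> zG; rewrite (mem_normal_Hall (nilpotent_pcore_Hall rho nilG)) ?pcore_normal //.
    exact: p_elt_constt.
  by rewrite groupX.
have [_ _ cO _] := dprodP (nilpotent_pcoreC pi nilG).
have cm u v : u \in G -> v \in G -> commute u.`_pi v.`_pi^'.
  by move=> uG vG; apply/esym/(centP (subsetP cO _ (inO _ _ vG)))/inO.
have pO u v : u \in G -> v \in G -> forall rho : nat_pred, rho.-elt (u.`_rho * v.`_rho).
  by move=> uG vG rho; apply: (mem_p_elt (pcore_pgroup rho G)); rewrite groupM ?inO.
have -> : x * y = (x.`_pi * y.`_pi) * (x.`_pi^' * y.`_pi^').
  rewrite -{1}(consttC pi x) -{1}(consttC pi y) -!mulgA; congr (_ * _).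
  by rewrite !mulgA (cm _ _ yG xG).
rewrite consttM; last first.
  by apply: commuteM; apply: commute_sym; apply: commuteM; apply: commute_sym; apply: cm.
rewrite (constt_p_elt (pO _ _ xG yG pi)).
by rewrite (constt1P (pO _ _ xG yG pi^')) mulg1.
Qed.

Lemma zexpg_nat (gT : finGroupType) (x : gT) (N n : nat) (z r : int) :
  x ^+ N = 1 -> (n%:Z = z + N%:Z * r)%R -> zexpg x z = x ^+ n.
Proof.
move=> xN; case: z => z e.
  by rewrite /zexpg /= -(expg_mod _ xN) -[RHS](expg_mod _ xN) ((eqmodnZ n z N).2 _) //; exists r.
rewrite /zexpg /=; apply: (mulIg (x ^+ z.+1)); rewrite mulVg -expgD -(expg_mod _ xN).
have -> : (n + z.+1 = 0 %[mod N])%N.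
  by apply/eqmodnZ; exists r; rewrite PoszD e NegzE; ring.
by rewrite mod0n.
Qed.

Lemma v2_odd (z : int) (m : nat) : z <> 0%R -> v2 z = m ->
  exists s : int, z = ((2 ^ m)%N%:Z * (2 * s + 1))%R.
Proof.
move=> z0 <-; have z_gt0 : (0 < `|z|)%N by rewrite absz_gt0; apply/eqP.
have [w] := pfactor_coprime (isT : prime 2) z_gt0.
rewrite coprime2n => w_odd; rewrite -/(v2 z); set p := (2 ^ _)%N => ew.
have := odd_double_half w; rewrite w_odd => ew2.
have [ez|ez] : (z = `|z|%N%:Z \/ z = - `|z|%N%:Z)%R by lia.
  by exists ((w./2)%:Z)%R; rewrite [LHS]ez ew -{1}ew2 PoszM; lia.
by exists (- (w./2)%:Z - 1)%R; rewrite [LHS]ez ew -{1}ew2 PoszM; lia.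
Qed.

(** Modulo an exponent [N] of the groups in play, the integers [alpha] and [beta] can be traded for
    natural numbers with the same 2-adic properties. *)
Lemma nat_exponents (alpha beta : int) (m N : nat) :
  alpha <> 1%R -> beta <> 1%R -> v2 (alpha - 1)%R = m -> v2 (beta - 1)%R = m ->
  (1 < m)%N -> alpha = beta \/ (2 * m <= v2 (alpha - beta)%R)%N -> (0 < N)%N ->
  exists u v d al be : nat, [/\ odd u, odd v, al = (2 ^ m * u).+1, be = (2 ^ m * v).+1 &
    [/\ al = (be + (2 ^ m) ^ 2 * d)%N, exists r, (al%:Z = alpha + N%:Z * r)%R
      & exists r, (be%:Z = beta + N%:Z * r)%R]].
Proof.
move=> a1 b1 va vb m1 hl N_gt0.
have [s es] : exists s, (alpha - 1 = (2 ^ m)%N%:Z * (2 * s + 1))%R.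
  by apply: v2_odd => // e; apply: a1; lia.
have [t et] : exists s, (beta - 1 = (2 ^ m)%N%:Z * (2 * s + 1))%R.
  by apply: v2_odd => // e; apply: b1; lia.
have [e ee] : exists e, (alpha - beta = (2 ^ m)%N%:Z ^+ 2 * e)%R.
  case: hl => [->|hl]; first by exists 0%R; rewrite mulr0 subrr.
  have : (((2 ^ m)%N%:Z ^+ 2)%R %| (alpha - beta)%R)%Z.
    rewrite dvdzE abszX /= -expnM mulnC.
    apply: dvdn_trans (pfactor_dvdnn 2 _); exact: dvdn_exp2l.
  by case/dvdzP=> e ->; exists e; rewrite mulrC.
have p4 : (4 <= 2 ^ m)%N by rewrite -[4%N]/(2 ^ 2)%N leq_exp2l.
move: es et ee p4; set p := (2 ^ m)%N => es et ee p4.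
(* The factor [2 p^2] preserves both the exact power of two in [alpha - 1], [beta - 1] and the
   congruence of the exponents modulo [p^2]. *)
pose N' := (N * 2 * p ^ 2)%N.
have N'_gt0 : (0 < N')%N by rewrite !muln_gt0 N_gt0 expn_gt0; lia.
have N'E : (N'%:Z = N%:Z * 2 * p%:Z ^+ 2)%R by rewrite /N' !PoszM; ring.
have residue (z : int) : exists n : nat, exists r : int, (n%:Z = z + N'%:Z * r)%R /\ (n < N')%N.
  exists `|(z %% N')%Z|%N, (- (z %/ N')%Z)%R.
  have zN0 : ((N' : int) != 0)%R by rewrite eqz_nat -lt0n.
  rewrite -ltz_nat gez0_abs ?modz_ge0 // ltz_pmod //; split=> //.
  by rewrite {2}(divz_eq z N'); ring.
have [al0 [r [eal lt_al]]] := residue alpha.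
have [be [r' [ebe lt_be]]] := residue beta.
have odd_part (n : nat) (z : int) : (n%:Z = 1 + p%:Z * (2 * z + 1))%R ->
    exists2 w, odd w & n = (p * w).+1.
  case: z => w en.
    exists (2 * w).+1; first by rewrite oddS oddM.
    have -> : (p * (2 * w).+1 = 2 * (p * w) + p)%N by ring.
    have e' : (n%:Z = 1 + 2 * (p%:Z * w%:Z) + p%:Z)%R by rewrite en; ring.
    by rewrite -PoszM in e'; lia.
  have e' : (n%:Z + 2 * (p%:Z * w%:Z) + p%:Z = 1)%R.
    by rewrite en NegzE (_ : w.+1%:Z = w%:Z + 1)%R; [ring | lia].
  by rewrite -PoszM in e'; lia.
(* Adding [N'] to the first residue puts it above the second, so that [d] is a natural number. *)
have [u u_odd eu] : exists2 u, odd u & (al0 + N')%N = (p * u).+1.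
  apply: (odd_part _ (s + N%:Z * p%:Z * (r + 1))%R).
  by rewrite PoszD eal N'E -[alpha](subrK 1%R) es; ring.
have [v v_odd ev] : exists2 v, odd v & be = (p * v).+1.
  apply: (odd_part _ (t + N%:Z * p%:Z * r')%R).
  by rewrite ebe N'E -[beta](subrK 1%R) et; ring.
have [d ed] : exists d, (al0 + N' = be + p ^ 2 * d)%N.
  have ed : ((al0 + N')%N%:Z - be%:Z = p%:Z ^+ 2 * (e + N%:Z * 2 * (r + 1 - r')))%R.
    by rewrite PoszD eal ebe N'E -[alpha](subrK beta) ee; ring.
  move: ed; set z := (e + _)%R; case: z => w ed.
    exists w; apply/eqP; rewrite -eqz_nat; apply/eqP.
    by apply: (addIr (- be%:Z)%R); rewrite ed [in RHS]PoszD PoszM -mulnn PoszM; ring.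
  have e' : (al0%:Z + N'%:Z + p%:Z ^+ 2 * (w.+1)%:Z = be%:Z)%R.
    by apply: (addIr (- be%:Z)%R); rewrite subrr -PoszD addrAC ed NegzE; ring.
  have : (0 <= p%:Z ^+ 2 * (w.+1)%:Z)%R by rewrite mulr_ge0 // exprn_ge0.
  by move: e' lt_be; set y := (_ * _)%R; lia.
exists u, v, d, (al0 + N')%N, be; split=> //; split=> //.
  by exists (2 * p%:Z ^+ 2 * (r + 1))%R; rewrite PoszD eal N'E; ring.
by exists (2 * p%:Z ^+ 2 * r')%R; rewrite ebe N'E; ring.
Qed.

Theorem theorem15p1 (alpha beta : int) (m : nat)
  (ha : alpha <> 1%R) (hb : beta <> 1%R)
  (hva : v2 (alpha - 1)%R = m) (hvb : v2 (beta - 1)%R = m) (hm : (1 < m)%N)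
  (hl : alpha = beta \/ (2 * m <= v2 (alpha - beta)%R)%N)
  (gT : finGroupType) (G : {group gT}) (A B : gT)
  (hG : is_Gab G A B alpha beta)
  (G2 : {group gT}) (hG2 : G2 \in 'Syl_2(G)) :
  let a := A.`_2 in let b := B.`_2 in let c := ([~ A, B]).`_2 in
  [/\ #|G2| = (2 ^ (7 * m - 3))%N,
      nil_class G2 = 5%N,
      #[a] = (2 ^ (3 * m - 1))%N,
      #[b] = (2 ^ (3 * m - 1))%N &
      #[c] = (2 ^ (2 * m))%N].
Proof.
move=> a b c; case: m hm hva hvb hl => [|[|k]] // _ hva hvb hl.
pose h := (2 ^ k.+1)%N; pose q := (2 * h ^ 2)%N.
pose X : finType := ('I_(4 * h ^ 3) * 'I_q * 'I_q)%type.
(* [N] is an exponent for both [gT] and the permutations of the model, so the same [al] and [be]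
   serve in both groups. *)
pose N := (#|[set: gT]| * #|[set: {perm X}]|)%N.
have N_gt0 : (0 < N)%N by rewrite muln_gt0 !cardG_gt0.
have [u [v [d [al [be [u_odd v_odd alE beE [al_be [r er] [r' er']]]]]]]] :=
  nat_exponents ha hb hva hvb isT hl N_gt0.
have h2 : (2 ^ k.+2 = 2 * h)%N by rewrite expnS.
rewrite h2 in alE beE al_be; rewrite expnMn in al_be.
have gTN (x : gT) : x ^+ N = 1.
  by rewrite /N expgM expg_cardG ?inE // expg1n.
have XN (x : {perm X}) : x ^+ N = 1.
  by rewrite /N mulnC expgM expg_cardG ?inE // expg1n.
have relsE (rT : finGroupType) (x y : rT) : (forall z : rT, z ^+ N = 1) ->
    rels_ab x y alpha beta = (x ^ [~ x, y] == x ^+ al) && (y ^ [~ y, x] == y ^+ be).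
  by move=> zN; rewrite /rels_ab (zexpg_nat (zN x) er) (zexpg_nat (zN y) er').
case: hG => defG; rewrite relsE // => /andP[/eqP relA /eqP relB] univ.
have nilG : nilpotent G by rewrite defG; apply: rels_nilpotent relA relB.
have AG : A \in G by rewrite defG mem_gen // !inE eqxx.
have BG : B \in G by rewrite defG mem_gen // !inE eqxx orbT.
have sAB : [set A; B] \subset G by rewrite subUset !sub1set AG.
have [sylG2 nG2] : 2.-Sylow(G) G2 /\ G2 <| G.
  have sylG2 : 2.-Sylow(G) G2 by rewrite inE in hG2.
  by split=> //; rewrite (nilpotent_Hall_pcore nilG sylG2) pcore_normal.
pose f := Morphism (@consttM_nil _ G 2%N nilG).
have fE x : f x = x.`_2 by [].
have G2E x : x \in G -> 2.-elt x -> x \in G2 by move=> xG x2; rewrite (mem_normal_Hall sylG2).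
have defG2 : G2 :=: <<[set a; b]>>.
  apply/eqP; rewrite eqEsubset; apply/andP; split; last first.
    rewrite gen_subG subUset !sub1set.
    by rewrite !G2E ?groupX ?p_elt_constt.
  have fAB : f @* <<[set A; B]>> = <<[set a; b]>>.
    by rewrite morphim_gen // morphimU !morphim_set1.
  rewrite -fAB -defG.
  apply/subsetP=> x xG2; have xG := subsetP (normal_sub nG2) x xG2.
  rewrite -(constt_p_elt (mem_p_elt (pHall_pgroup sylG2) xG2)) -fE.
  exact: mem_morphim.
have cE : c = [~ a, b] by rewrite /c -fE morphR.
have rela : a ^ [~ a, b] = a ^+ al.
  by rewrite -cE /a /c -!fE -morphJ ?groupR // relA morphX.
have relb : b ^ [~ b, a] = b ^+ be.
  rewrite -[in LHS]invg_comm -cE /b /c -!fE -morphV ?groupR // -morphJ ?groupV ?groupR //.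
  by rewrite invg_comm relB morphX.
have hE : h = (2 ^ k.+1)%N by [].
have G2_2 : 2.-group <<[set a; b]>> by rewrite -defG2 (pHall_pgroup sylG2).
have [x [y [relx rely dvdX]]] := model_exists v_odd hE alE beE al_be.
have qE : (4 * h ^ 3 * q * q = 2 ^ (7 * k.+2 - 3))%N.
  have -> : (4 * h ^ 3 * q * q = 2 ^ 4 * h ^ 7)%N by rewrite /q; ring.
  by rewrite -expnM -expnD; congr (2 ^ _)%N; lia.
have h3E : (4 * h ^ 3 = 2 ^ (3 * k.+2 - 1))%N.
  by rewrite -expnM -[4%N]/(2 ^ 2)%N -expnD; congr (2 ^ _)%N; lia.
(* By the universal property [G] maps onto the group of the model, so the power of two
   [2 ^ (7m - 3)] divides [#|G|], hence its 2-part [#|G2|]. *)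
have leG2 : (4 * h ^ 3 * q * q <= #|<<[set a; b]>>|)%N.
  have rxy : rels_ab x y alpha beta by rewrite relsE // relx rely !eqxx.
  have [g [gA gB]] := univ _ x y rxy.
  have gG : g @* G = <<[set x; y]>>.
    have <- : g @* <<[set A; B]>> = <<[set x; y]>>.
      by rewrite morphim_gen // morphimU !morphim_set1 // gA gB.
    by rewrite -defG.
  rewrite -defG2 (card_Hall sylG2) dvdn_leq ?part_gt0 // qE.
  have dvdG : (2 ^ (7 * k.+2 - 3) %| #|G|)%N.
    by rewrite -qE (dvdn_trans dvdX) // -gG dvdn_morphim.
  rewrite -(part_pnat_id (pi := 2) (n := 2 ^ _)) ?partn_dvd // pnatX pnat_id ?orbT //.
have [oG oa ob oc] := orders_upper u_odd v_odd hE alE beE al_be rela relb G2_2 leG2.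
split.
- by rewrite defG2 oG.
- rewrite defG2; apply/eqP; rewrite eqn_leq.
  rewrite (nil_class_upper u_odd v_odd hE alE beE al_be rela relb G2_2).
  by rewrite (nil_class_lower u_odd hE alE rela G2_2 oa).
- by rewrite oa; apply: h3E.
- by rewrite ob; apply: h3E.
by rewrite cE oc /h -expnM -!expnS; congr (2 ^ _)%N; lia.
Qed.
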